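(* Let $G_k(r)=(4-r^2)^k$ for $k=1,2,3,\dots$ and let $G^{\#}_{10}=G_{10}+28G_5+102G_2$. For each $f\in\{G_3,G_4,G_5,G_6,G^{\#}_{10}\}$, the triangular bi-pyramid is the unique minimizer of the energy $\mathcal{E}_f(P)=\sum_{i<j} f(\|p_i-p_j\|)$ among all configurations $P=\{p_1,\dots,p_5\}$ of $5$ pairwise distinct points on the unit sphere $S^2\subset\mathbb{R}^3$ (uniqueness up to isometries of $S^2$).
   Context: The triangular bi-pyramid (TBP) is the configuration of 5 points on $S^2$ consisting of the north pole $(0,0,1)$, the south pole $(0,0,-1)$, and three points forming an equilateral triangle on the equator $\{z=0\}$. Norms are Euclidean norms in $\mathbb{R}^3$. *)

(* Defs.v *)
From mathcomp Require Import all_boot all_order all_algebra all_fingroup.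
From mathcomp Require Import reals.
Set Implicit Arguments. Unset Strict Implicit. Unset Printing Implicit Defensive.
Import Order.TTheory GRing.Theory Num.Theory.
Local Open Scope ring_scope.

Section Defs.
Variable R : realType.

Definition norm3 (v : 'rV[R]_3) : R := Num.sqrt (\sum_(i < 3) v 0 i ^+ 2).

Definition vec3 (a b c : R) : 'rV[R]_3 :=
  \row_(i < 3) [:: a; b; c]`_i.

(* The triangular bi-pyramid: north pole, south pole, and an equilateral
   triangle on the equator. *)
Definition tbp (i : 'I_5) : 'rV[R]_3 :=
  match val i with
  | 0 => vec3 0 0 1
  | 1 => vec3 0 0 (-1)
  | 2 => vec3 1 0 0
  | 3 => vec3 (- (1/2)) (Num.sqrt 3 / 2) 0
  | _ => vec3 (- (1/2)) (- (Num.sqrt 3 / 2)) 0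
  end.

Definition G (k : nat) (r : R) : R := (4 - r ^+ 2) ^+ k.

Definition Gsharp10 (r : R) : R := G 10 r + 28 * G 5 r + 102 * G 2 r.

Definition energy (f : R -> R) (p : 'I_5 -> 'rV[R]_3) : R :=
  \sum_(i < 5) \sum_(j < 5 | (i < j)%N) f (norm3 (p i - p j)).

End Defs.

(* Main.v *)
From Stdlib Require Import ZArith.
Require Import Defs.
From mathcomp Require Import all_boot all_order all_algebra all_fingroup.
From mathcomp Require Import reals ssrZ zify ring lra.
Set Implicit Arguments.
Unset Strict Implicit.
Unset Printing Implicit Defensive.
Import Order.TTheory GRing.Theory Num.Theory.
Local Open Scope ring_scope.
Delimit Scope Z_scope with ZZ.

(** With [x_ij] the inner products of the five points and [u = 1 + x], one has [G_k = (2 u)^k], so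
    each energy is a polynomial in the Gram matrix. Up to averaging over ['S_5] and up to
    multiples of the 4 x 4 minors of the Gram matrix (which vanish in dimension 3), the energy
    minus its value at the bi-pyramid is a sum of squared norms [|sum_k c_k v_k|^2], where each
    [v_k] is a combination of the points whose coefficients are polynomials in the [x_ij] and
    which vanishes at every labelled bi-pyramid. For [G_5] and [G#_10] the potential is first
    replaced by a smaller polynomial of degree 4, resp. 7, that agrees with it at the bi-pyramid,
    where [u] is 0, 1/2 or 1. The squares were found by semidefinite programming over
    ['S_5]-symmetric certificates and rounded to exact ones.

    Each certificate also contains a positive multiple of [|sum_i p_i|^2] and of the squares
    [(x_ij (x_ik - x_jk))^2]. When these vanish, [x_ij <> 0] is an equivalence relation, [x] is
    constant on each class, and no class is a singleton; classes of sizes 2 and 3 give the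
    bi-pyramid, and a single class is the simplex, which needs four dimensions. *)

(** The bound is attained, so at equality every square has to vanish at all labelings of the
    bi-pyramid. Admitting only vectors that vanish there from the start removes the forced kernel of
    the matrix of the quadratic form; what remains can be positive definite, and then a numerical
    solution survives rounding to integers. Averaging over ['S_5] turns monomials in the [x_ij] into
    multigraphs on five vertices up to isomorphism, so the identity behind a certificate is compared
    coefficient by coefficient on isomorphism classes. All data are of the binary type [Z], which
    lets a whole certificate be checked by one evaluation; only the conclusion is transported to the
    real field by [zr]. The two squares used for uniqueness are split off with explicit positive
    weights. Otherwise the equality case would have to be read from a large system of vanishing
    vectors. *)

Definition zr (R : realType) (c : Z) : R := (ssrZ.int_of_Z c)%:~R.

Section IntegerCast.
Variable R : realType.
Local Notation zr := (@zr R).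

Lemma zr0 : zr 0%ZZ = 0. Proof. by []. Qed.
Lemma zr1 : zr 1%ZZ = 1. Proof. by []. Qed.
Lemma zrN1 : zr (-1)%ZZ = -1. Proof. by []. Qed.
Lemma zrD a b : zr (a + b)%ZZ = zr a + zr b.
Proof. by rewrite /zr -intrD; congr (_%:~R); lia. Qed.
Lemma zrM a b : zr (a * b)%ZZ = zr a * zr b.
Proof. by rewrite /zr -intrM; congr (_%:~R); lia. Qed.
Lemma zrN a : zr (- a)%ZZ = - zr a.
Proof. by rewrite /zr -rmorphN /=; congr (_%:~R); lia. Qed.
Lemma zrB a b : zr (a - b)%ZZ = zr a - zr b.
Proof. by rewrite -zrN -zrD. Qed.
Lemma zr_le a b : (a <=? b)%ZZ -> zr a <= zr b.
Proof. by move=> h; rewrite /zr ler_int; lia. Qed.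
Lemma zr_ge0 a : (0 <=? a)%ZZ -> 0 <= zr a.
Proof. exact: zr_le. Qed.
Lemma zr_gt0 a : (0 <? a)%ZZ -> 0 < zr a.
Proof. by move=> h; rewrite /zr ltr0z; lia. Qed.
Lemma zr_abs a : zr (Z.abs a) = `|zr a|.
Proof. by rewrite /zr -intr_norm; congr (_%:~R); lia. Qed.
End IntegerCast.

(** * Integer polynomials in one variable, constant coefficient first *)

Fixpoint zpadd (a b : seq Z) : seq Z :=
  match a, b with
  | [::], _ => b
  | _, [::] => a
  | c :: a', d :: b' => (c + d)%ZZ :: zpadd a' b'
  end.
Definition zpscale (c : Z) (a : seq Z) : seq Z := [seq (c * d)%ZZ | d <- a].
Definition zpmul (a b : seq Z) : seq Z :=
  foldr (fun c s => zpadd (zpscale c b) (0%ZZ :: s)) [::] a.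
(** Horner's rule for the substitution of [1 + t]: it turns a polynomial in [u] into one in the
    inner product [x = u - 1]. *)
Definition zpshift (a : seq Z) : seq Z :=
  foldr (fun c s => zpadd [:: c] (zpadd s (0%ZZ :: s))) [::] a.
Definition zpeval (a : seq Z) (t : Z) : Z := foldr (fun c s => (c + t * s)%ZZ) 0%ZZ a.
(** The value at 1/2, which is [u] for two equatorial points, times [2 ^ size a] so that it stays an
    integer. *)
Fixpoint zphalf (a : seq Z) : Z :=
  if a is c :: s then (c * 2 ^ Z.of_nat (size a) + zphalf s)%ZZ else 0%ZZ.

Section IntegerPolynomials.
Variable R : realType.
Local Notation zr := (@zr R).
Implicit Types (a b : seq Z) (t : R).

Definition zp_val a t : R := foldr (fun c s => zr c + t * s) 0 a.

Lemma zp_valE a t : zp_val a t = \sum_(0 <= k < size a) zr (nth 0%ZZ a k) * t ^+ k.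
Proof.
elim: a => [|c a IH]; first by rewrite big_nil.
rewrite /= IH big_nat_recl //= expr0 mulr1; congr (_ + _).
by rewrite mulr_sumr; apply: eq_bigr => k _; rewrite exprS mulrCA.
Qed.
Lemma zp_val_add a b t : zp_val (zpadd a b) t = zp_val a t + zp_val b t.
Proof.
elim: a b => [|c a IH] [|d b] //=; rewrite ?add0r ?addr0 //.
by rewrite zrD IH; ring.
Qed.
Lemma zp_val_scale c a t : zp_val (zpscale c a) t = zr c * zp_val a t.
Proof. by elim: a => [|d a IH]; rewrite /= ?mulr0 // zrM IH; ring. Qed.
Lemma zp_val_mul a b t : zp_val (zpmul a b) t = zp_val a t * zp_val b t.
Proof.
elim: a => [|c a IH]; first by rewrite /= mul0r.
by rewrite /= zp_val_add zp_val_scale /= IH zr0; ring.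
Qed.
Lemma zp_val_shift a t : zp_val (zpshift a) t = zp_val a (1 + t).
Proof.
elim: a => [//|c a IH].
rewrite -[zpshift (c :: a)]/(zpadd [:: c] (zpadd (zpshift a) (0%ZZ :: zpshift a))).
by rewrite !zp_val_add /= IH zr0; ring.
Qed.
Lemma zr_zpeval a c : zr (zpeval a c) = zp_val a (zr c).
Proof. by elim: a => [//|d a IH]; rewrite /= zrD zrM IH. Qed.
Lemma zr_pow2 n : zr (2 ^ Z.of_nat n)%ZZ = 2 ^+ n.
Proof.
elim: n => [//|n IH]; rewrite Nat2Z.inj_succ Z.pow_succ_r; last exact: Nat2Z.is_nonneg.
by rewrite zrM IH exprS.
Qed.
Lemma zr_zphalf a : zr (zphalf a) = 2 ^+ size a * zp_val a 2^-1.
Proof.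
elim: a => [|c a IH]; first by rewrite mulr0.
by rewrite [zphalf _]/(Z.add _ _) zrD zrM zr_pow2 IH /= exprS; field.
Qed.
Lemma zp_val_ge0 a t : all (Z.leb 0) a -> 0 <= t -> 0 <= zp_val a t.
Proof.
move=> + t0; elim: a => [//|c a IH] /= /andP[/(zr_ge0 R) c0 /IH h].
by rewrite addr_ge0 // mulr_ge0.
Qed.
End IntegerPolynomials.

(** * The certificate checker *)

(* A monomial in the inner products [x_ij] is the list of its edges [(i, j)], and a triple
   [(c, m, i)] stands for the vector [c * m * p_i]. *)
Notation edge := (nat * nat)%type.
Notation mono := (seq (nat * nat)).
Notation poly := (seq (Z * seq (nat * nat))).
Notation vpoly := (seq (Z * seq (nat * nat) * nat)).

Definition edges : seq edge :=
  [:: (0, 1); (0, 2); (0, 3); (0, 4); (1, 2); (1, 3); (1, 4); (2, 3); (2, 4); (3, 4)]%N.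
(* The loops [(i, i)], which stand for the constant 1, get the out-of-range index 10. *)
Definition edge_index (i j : nat) : nat :=
  nth 10%N (nth [::] [:: [:: 10; 0; 1; 2; 3]; [:: 0; 10; 4; 5; 6]; [:: 1; 4; 10; 7; 8];
                         [:: 2; 5; 7; 10; 9]; [:: 3; 6; 8; 9; 10]]%N i) j.
(** An index beyond the end changes nothing; this is how the index 10 of a loop acts as the factor
    1. *)
Fixpoint incr (k : nat) (l : seq nat) : seq nat :=
  match l, k with
  | [::], _ => [::]
  | a :: l', 0%N => a.+1 :: l'
  | a :: l', k'.+1 => a :: incr k' l'
  end.
Definition exponents (m : mono) : seq nat :=
  foldr (fun e l => incr (edge_index e.1 e.2) l) (nseq 10 0%N) m.

(* Sparse Horner form: at the variable [X_k], [HNode t1 t2] is [t1 + X_k * t2] with [t1] a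
   polynomial in the later variables. *)
Inductive htree := HZero | HLeaf of Z | HNode of htree & htree.
(** A step into the right branch uses up one factor of the current variable and stays at that
    variable; a step into the left branch passes to the next one. Missing nodes are created on the
    way, and a leaf met too early becomes the constant term of the new node. *)
Fixpoint hadd (c : Z) (l : seq nat) : htree -> htree :=
  match l with
  | [::] => fix leaf t := match t with
      | HZero => HLeaf c
      | HLeaf c' => HLeaf (c + c')
      | HNode t1 t2 => HNode (leaf t1) t2
      end
  | e :: l' => (fix walk e t := match e, t with
      | 0%N, HZero => HNode (hadd c l' HZero) HZero
      | 0%N, HLeaf c' => HNode (hadd c l' (HLeaf c')) HZero
      | 0%N, HNode t1 t2 => HNode (hadd c l' t1) t2
      | e'.+1, HZero => HNode HZero (walk e' HZero)
      | e'.+1, HLeaf c' => HNode (HLeaf c') (walk e' HZero)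
      | e'.+1, HNode t1 t2 => HNode t1 (walk e' t2)
      end) e
  end.
Definition hbuild (p : poly) : htree :=
  foldl (fun t cm => hadd cm.1 (exponents cm.2) t) HZero p.
Fixpoint hterms (k : nat) (t : htree) (m : mono) : poly :=
  match t with
  | HZero => [::]
  | HLeaf c => if (c =? 0)%ZZ then [::] else [:: (c, m)]
  | HNode t1 t2 => hterms k.+1 t1 m ++ hterms k t2 (nth (0, 0)%N edges k :: m)
  end.
Fixpoint hzero (t : htree) : bool :=
  match t with
  | HZero => true
  | HLeaf c => (c =? 0)%ZZ
  | HNode t1 t2 => hzero t1 && hzero t2
  end.

(** * Relabelings and orbit representatives of monomials *)

Definition relabel (s : seq nat) (m : mono) : mono :=
  [seq (nth 0%N s e.1, nth 0%N s e.2) | e <- m].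
Definition vrelabel (s : seq nat) (y : vpoly) : vpoly :=
  [seq (t.1.1, relabel s t.1.2, nth 0%N s t.2) | t <- y].
Definition is_relabeling (s : seq nat) : bool :=
  [&& size s == 5%N, all (fun i => i < 5)%N s & uniq s].
(** Each arrangement is paired with its inverse: the first lists the vertices by place, the second
    sends a vertex to its place and is the relabeling that gets applied. *)
Definition arrangements : seq (seq nat * seq nat) :=
  [seq (s, [seq index i s | i <- iota 0 5]) | s <- permutations (iota 0 5)].

Definition degrees (m : mono) : seq nat :=
  foldr (fun e l => if e.1 == e.2 then l else incr e.1 (incr e.2 l)) (nseq 5 0%N) m.
Fixpoint add_nth (c i : nat) (l : seq nat) : seq nat :=
  match l, i with
  | [::], _ => [::]
  | a :: l', 0%N => (a + c)%N :: l'
  | a :: l', i'.+1 => a :: add_nth c i' l'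
  end.
(** One round of colour refinement: ten times the degree of a vertex plus the degrees of its
    neighbours, counted with multiplicity. *)
Definition vertex_keys (m : mono) : seq nat :=
  let d := degrees m in
  foldr (fun e l => if e.1 == e.2 then l else
      add_nth (nth 0%N d e.2) e.1 (add_nth (nth 0%N d e.1) e.2 l))
    [seq (10 * i)%N | i <- d] m.
Fixpoint descending (ks : seq nat) (b : nat) (s : seq nat) : bool :=
  if s is i :: s' then
    let k := nth 0%N ks i in if (k <= b)%N then descending ks k s' else false
  else true.
Fixpoint lex (a b : seq nat) : bool :=
  match a, b with
  | x :: a', y :: b' => if (x < y)%N then true else if x == y then lex a' b' else false
  | [::], _ :: _ => true
  | _, _ => false
  end.
(* The vertex keys are isomorphism invariants of the multigraph [m]; they only serve to cut down
   the number of relabelings among which the lexicographically largest one is taken. *)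
Definition canonical (arr : seq (seq nat * seq nat)) (m : mono) : mono :=
  let ks := vertex_keys m in
  let cand := [seq relabel s.2 m | s <- arr & descending ks 1000 s.1] in
  (foldl (fun b c => let e := exponents c in if lex b.1 e then (e, c) else b) ([::], m) cand).2.
(** The first tree merges equal monomials, so that the costly canonical form is computed once for
    each; the second merges the monomials of one orbit. *)
Definition sym_zero (p : poly) : bool :=
  let arr := arrangements in
  hzero (hbuild [seq (cm.1, canonical arr cm.2) | cm <- hterms 0 (hbuild p) [::]]).

(** * The polynomials assembled from the data of a certificate *)

(** The 12 symmetries of the labelled bi-pyramid with poles 0, 1 and equator 2, 3, 4. *)
Definition subgroupH : seq (seq nat) :=
  [seq a ++ b | a <- [:: [:: 0; 1]; [:: 1; 0]]%N,
     b <- [:: [:: 2; 3; 4]; [:: 2; 4; 3]; [:: 3; 2; 4]; [:: 3; 4; 2]; [:: 4; 2; 3]; [:: 4; 3; 2]]%N].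
Definition vsum (y : vpoly) : vpoly := flatten [seq vrelabel s y | s <- subgroupH].
(** The inner product of two points is itself one of the variables, here the edge [(t.2, u.2)], so
    the dot product of two such vectors is again a polynomial in the [x_ij]. *)
Definition vdot (c : Z) (y z : vpoly) : poly :=
  [seq ((c * (t.1.1 * u.1.1))%ZZ, (t.2, u.2) :: t.1.2 ++ u.1.2) | t <- y, u <- z].

Definition entry (M : seq (seq Z)) (k l : nat) : Z := nth 0%ZZ (nth [::] M k) l.
(* Symmetric matrices are stored by their lower triangle, with the off-diagonal entries doubled.
   Only one factor is summed over the subgroup: after symmetrisation this makes no difference
   up to a factor 12 (lemma [sum_vsum]). *)
Definition gram_poly (ys : seq vpoly) (M : seq (seq Z)) : poly :=
  let Py := [seq vsum y | y <- ys] in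
  flatten [seq flatten [seq vdot (entry M k l) (nth [::] Py k) (nth [::] ys l)
     | l <- iota 0 k.+1] | k <- iota 0 (size ys)].
Definition zsum (f : nat -> Z) (s : seq nat) : Z := foldr (fun i a => (f i + a)%ZZ) 0%ZZ s.
Definition zdot (a b : seq Z) : Z := foldr (fun t s => (t.1 * t.2 + s)%ZZ) 0%ZZ (zip a b).
(** [M - mu * L * L^T], in the same triangular storage with doubled off-diagonal entries. *)
Definition residue (n : nat) (mu : Z) (M L : seq (seq Z)) : seq (seq Z) :=
  [seq [seq (entry M k l -
             (if l == k then mu else 2 * mu) * zdot (nth [::] L k) (nth [::] L l))%ZZ
     | l <- iota 0 k.+1] | k <- iota 0 n].
(** The right of row [k] is read from column [k] of the triangle. Because off-diagonal entries are
    stored doubled, the factor 2 on the diagonal gives ordinary row dominance. *)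
Definition dominant (n : nat) (D : seq (seq Z)) : bool :=
  all (fun k => (zsum (fun l => Z.abs (entry D k l)) (iota 0 k) +
                 zsum (fun l => Z.abs (entry D l k)) (iota k.+1 (n - k.+1))
                 <=? 2 * entry D k k)%ZZ)
    (iota 0 n).
(* [M] is [mu * L * L^T] plus a diagonally dominant matrix; [L] is a rounded Cholesky factor. *)
Definition psd (n : nat) (mu : Z) (M L : seq (seq Z)) : bool :=
  (0 <=? mu)%ZZ && dominant n (residue n mu M L).

(* The two 4 x 4 minors of the Gram matrix, on the rows 0123 and the columns 0123 and 0124. *)
Definition minors : seq poly :=
  [seq [seq (foldr Z.mul 1%ZZ
               [seq (if (nth 0 s i < nth 0 s j)%N then 1 else -1)%ZZ | j <- iota 0 4, i <- iota 0 j],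
             [seq (i, nth 0%N c (nth 0%N s i)) | i <- iota 0 4])
       | s <- permutations (iota 0 4)]
  | c <- [:: [:: 0; 1; 2; 3]; [:: 0; 1; 2; 4]]%N].
(** A triple [(c, m, k)] stands for [c * m] times the [k]-th minor. Up to relabeling and sign, a 4 x
    4 minor is determined by whether its rows and its columns omit the same point, so under
    averaging two minors represent all of them. *)
Definition ideal_poly (I : seq (Z * mono * nat)) : poly :=
  flatten [seq [seq ((t.1.1 * u.1)%ZZ, t.1.2 ++ u.2) | u <- nth [::] minors t.2] | t <- I].
Definition all_pairs : seq edge := [seq (i, j) | i <- iota 0 5, j <- iota 0 5].
(** All 25 ordered pairs are summed; the diagonal ones contribute a constant, for which [C] has to
    allow. *)
Definition energy_poly (phi : seq Z) (C : Z) : poly :=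
  (C, [::]) :: flatten [seq [seq ((- nth 0%ZZ phi k)%ZZ, nseq k e) | k <- iota 0 (size phi)]
                       | e <- all_pairs].
(* [e2 * (x01 (x02 - x12))^2 + e1 * sum_ij xij]: the terms that force uniqueness. *)
Definition extra_poly (e1 e2 : Z) : poly :=
  [:: (e2, [:: (0, 1); (0, 1); (0, 2); (0, 2)]%N);
      ((e2 * -2)%ZZ, [:: (0, 1); (0, 1); (0, 2); (1, 2)]%N);
      (e2, [:: (0, 1); (0, 1); (1, 2); (1, 2)]%N)]
  ++ [seq (e1, [:: e]) | e <- all_pairs].
(** When the average over ['S_5] vanishes, the sum of [phi] minus [C] equals the squares plus the
    extra terms, modulo the minors. *)
Definition total phi C e1 e2 ys M I :=
  gram_poly ys M ++ ideal_poly I ++ extra_poly e1 e2 ++ energy_poly phi C.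

(** * Soundness of the checker *)

Section Evaluation.
Variable R : realType.
Local Notation zr := (@zr R).
Implicit Types (x : 'I_5 -> 'I_5 -> R) (m : mono) (p : poly).

Definition mono_val x m : R := \prod_(e <- m) x (inord e.1) (inord e.2).
Definition poly_val x p : R := \sum_(t <- p) zr t.1 * mono_val x t.2.

Lemma mono_val_cat x m m' : mono_val x (m ++ m') = mono_val x m * mono_val x m'.
Proof. by rewrite /mono_val big_cat. Qed.
Lemma mono_val_cons x e m : mono_val x (e :: m) = x (inord e.1) (inord e.2) * mono_val x m.
Proof. by rewrite /mono_val big_cons. Qed.
Lemma poly_val_cons x t (q : poly) : poly_val x (t :: q) = zr t.1 * mono_val x t.2 + poly_val x q.
Proof. by rewrite /poly_val big_cons. Qed.
Lemma poly_val_cat x p p' : poly_val x (p ++ p') = poly_val x p + poly_val x p'.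
Proof. by rewrite /poly_val big_cat. Qed.
Lemma poly_val_flatten x (ps : seq poly) : poly_val x (flatten ps) = \sum_(p <- ps) poly_val x p.
Proof. by rewrite /poly_val big_flatten. Qed.

(** A form that computes once the polynomial is an explicit list; it serves to expand the minors. *)
Lemma poly_val_foldr x (q : poly) : poly_val x q =
  foldr (fun t s => zr t.1 * foldr (fun e s => x (inord e.1) (inord e.2) * s) 1 t.2 + s) 0 q.
Proof. by rewrite /poly_val /mono_val unlock; elim: q => //= t q ->; rewrite unlock. Qed.

Section Tree.
Variable v : nat -> R.
Fixpoint exponents_val k (l : seq nat) : R := if l is e :: l' then v k ^+ e * exponents_val k.+1 l' else 1.
Fixpoint htree_val k (t : htree) : R :=
  match t with
  | HZero => 0 | HLeaf c => zr c | HNode t1 t2 => htree_val k.+1 t1 + v k * htree_val k t2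
  end.

Lemma htree_val_hadd c l k t : htree_val k (hadd c l t) = htree_val k t + zr c * exponents_val k l.
Proof.
elim: l k t => [|e l IH] k t /=.
  elim: t k => [|c'|t1 IH1 t2 _] k /=; first by ring.
    by rewrite zrD; ring.
  by rewrite IH1; ring.
elim: e t => [|e IHe] [|c'|t1 t2] /=; rewrite ?IH ?IHe /= ?exprS ?expr0; ring.
Qed.

Lemma exponents_val_incr k j l : (j < size l)%N -> exponents_val k (incr j l) = v (k + j)%N * exponents_val k l.
Proof.
elim: l k j => [//|a l IH] k [|j] /= h; first by rewrite addn0 exprS mulrA.
by rewrite IH // addSnnS; ring.
Qed.
Lemma size_incr j l : size (incr j l) = size l.
Proof. by elim: l j => [//|a l IH] [|j] //=; rewrite IH. Qed.
Lemma incr_oversize j l : (size l <= j)%N -> incr j l = l.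
Proof. by elim: l j => [//|a l IH] [|j] //= h; rewrite IH. Qed.
Lemma hzeroP t : hzero t -> forall k, htree_val k t = 0.
Proof.
elim: t => [//|c|t1 IH1 t2 IH2] /=; first by move/Z.eqb_eq=> -> k.
by move=> /andP[/IH1 h1 /IH2 h2] k; rewrite h1 h2; ring.
Qed.
End Tree.

(** The two facts that [exponents] builds in: an edge has no direction, and a loop is the constant
    1. *)
Definition unit_gram x := (forall i j, x i j = x j i) /\ (forall i, x i i = 1).
Definition edge_val x k : R :=
  x (inord (nth (0, 0)%N edges k).1) (inord (nth (0, 0)%N edges k).2).
Definition valid_mono m : bool := all (fun e => (e.1 < 5) && (e.2 < 5))%N m.

Lemma size_exponents m : size (exponents m) = 10%N.
Proof. by elim: m => [//|e m IH]; rewrite /= size_incr IH. Qed.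

Lemma exponents_val_exponents x m : unit_gram x -> valid_mono m ->
  exponents_val (edge_val x) 0 (exponents m) = mono_val x m.
Proof.
move=> [xC x1]; elim: m => [|[i j] m IH]; first by rewrite /mono_val big_nil /= !expr0 !mulr1.
move=> /= /andP[/andP[/= hi hj] /IH {}IH]; rewrite mono_val_cons -IH /=.
have [<-|ij] := eqVneq i j.
  rewrite incr_oversize ?x1 ?mul1r // size_exponents.
  by move: i hi {hj} => [|[|[|[|[|]]]]].
have ex : (edge_index i j < 10)%N.
  by move: i j hi hj ij => [|[|[|[|[|]]]]] // [|[|[|[|[|]]]]].
rewrite exponents_val_incr ?size_exponents //; congr (_ * _).
by move: i j hi hj ij {ex} => [|[|[|[|[|]]]]] // [|[|[|[|[|]]]]] //= _ _ _;
  rewrite /edge_val /= // xC.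
Qed.

Definition valid p : bool := all (fun t => valid_mono t.2) p.

Lemma htree_val_hbuild x p : unit_gram x -> valid p ->
  htree_val (edge_val x) 0 (hbuild p) = poly_val x p.
Proof.
move=> gx; rewrite /hbuild.
suff H t : valid p -> htree_val (edge_val x) 0 (foldl (fun t cm => hadd cm.1 (exponents cm.2) t) t p)
   = htree_val (edge_val x) 0 t + poly_val x p by move/H ->; rewrite /= add0r.
elim: p t => [|[c m] p IH] t /=; first by rewrite /poly_val big_nil addr0.
move=> /andP[vm vp]; rewrite IH // htree_val_hadd exponents_val_exponents //.
by rewrite /poly_val big_cons /= addrA.
Qed.

Lemma poly_val_hterms x t k m : poly_val x (hterms k t m) = mono_val x m * htree_val (edge_val x) k t.
Proof.
elim: t k m => [|c|t1 IH1 t2 IH2] k m /=; first by rewrite /poly_val big_nil mulr0.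
  case: Z.eqb_spec => [->|_]; first by rewrite /poly_val big_nil zr0 mulr0.
  by rewrite /poly_val big_seq1 /= mulrC.
by rewrite poly_val_cat IH1 IH2 mono_val_cons -/(edge_val x k); ring.
Qed.

Lemma valid_hterms t k m : valid_mono m -> valid (hterms k t m).
Proof.
elim: t k m => [|c|t1 IH1 t2 IH2] k m vm //=.
  by case: Z.eqb => //=; rewrite vm.
rewrite /valid all_cat -/(valid _) IH1 //= -/(valid _) IH2 //= vm andbT.
(* Past the tenth edge the default [(0, 0)] is read, which is a valid loop. *)
by move: k {IH1 IH2} => [|[|[|[|[|[|[|[|[|[|k]]]]]]]]]] //=; rewrite nth_nil.
Qed.

Definition permuted x (s : 'S_5) : 'I_5 -> 'I_5 -> R := fun i j => x (s i) (s j).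
Lemma unit_gram_permuted x s : unit_gram x -> unit_gram (permuted x s).
Proof. by move=> [xC x1]; split=> [i j|i]; [exact: xC|exact: x1]. Qed.
Definition represents (l : seq nat) (s : 'S_5) : Prop :=
  forall i, (i < 5)%N -> s (inord i) = inord (nth 0%N l i).

Lemma relabelingP l : is_relabeling l -> exists s, represents l s.
Proof.
case/and3P=> /eqP sl /all_nthP al ul.
have inj : injective (fun i : 'I_5 => (inord (nth 0%N l i) : 'I_5)).
  move=> i j /(congr1 val); rewrite /= !inordK ?al ?sl // => /eqP.
  by rewrite nth_uniq ?sl // => /eqP /val_inj.
by exists (perm inj) => i hi; rewrite permE inordK.
Qed.

Lemma mono_val_relabel x l s m : represents l s -> valid_mono m ->
  mono_val x (relabel l m) = mono_val (permuted x s) m.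
Proof.
move=> ls; rewrite /mono_val /relabel big_map => /allP vm.
by apply: eq_big_seq => e /vm /andP[h1 h2]; rewrite /permuted !ls.
Qed.

Definition sym_mono_val x m : R := \sum_(s : 'S_5) mono_val (permuted x s) m.
Definition sym_poly_val x p : R := \sum_(s : 'S_5) poly_val (permuted x s) p.

Lemma sym_poly_valE x p : sym_poly_val x p = \sum_(t <- p) zr t.1 * sym_mono_val x t.2.
Proof.
rewrite /sym_poly_val exchange_big /=; apply: eq_bigr => t _.
by rewrite /sym_mono_val mulr_sumr.
Qed.
(** Translation by [t] is a bijection of the group, so a sum over ['S_5] absorbs any relabeling. *)
Lemma sum_permuted (F : ('I_5 -> 'I_5 -> R) -> R) x (t : 'S_5) :
  \sum_(s : 'S_5) F (permuted (permuted x s) t) = \sum_(s : 'S_5) F (permuted x s).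
Proof.
rewrite [RHS](reindex_inj (mulgI t)) /=; apply: eq_bigr => s _.
rewrite /permuted; congr F; apply: boolp.funext => i; apply: boolp.funext => j.
by rewrite !permM.
Qed.

Lemma valid_relabel l m : is_relabeling l -> valid_mono (relabel l m).
Proof.
case/and3P=> /eqP sl al _; apply/allP => e /mapP[e' _ ->] /=.
have H i : (nth 0 l i < 5)%N.
  case: (ltnP i (size l)) => h; last by rewrite nth_default.
  by move/all_nthP: al; apply.
by rewrite !H.
Qed.

Lemma sym_mono_val_relabel x l m : is_relabeling l -> valid_mono m ->
  sym_mono_val x (relabel l m) = sym_mono_val x m.
Proof.
move=> rl vm; case: (relabelingP rl) => t lt; rewrite /sym_mono_val.
under eq_bigr do rewrite (mono_val_relabel _ lt) //.
exact: (sum_permuted (mono_val^~ m)).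
Qed.
End Evaluation.

(** * Canonical forms, and vectors summed over the symmetries of the bi-pyramid *)

Section Squares.
Variable R : realType.
Local Notation zr := (@zr R).
Implicit Types (x : 'I_5 -> 'I_5 -> R) (m : mono) (p : 'I_5 -> 'rV[R]_3).

(** All that soundness uses of the canonical form: it lies in the orbit of [m]. The first case is
    the start value of the fold. *)
Lemma canonicalP arr m :
  canonical arr m = m \/ exists2 s, s \in arr & canonical arr m = relabel s.2 m.
Proof.
rewrite /canonical; set ks := vertex_keys m.
have: forall c, c \in [seq relabel s.2 m | s <- arr & descending ks 1000 s.1] ->
    exists2 s, s \in arr & c = relabel s.2 m.
  by move=> c /mapP[s]; rewrite mem_filter => /andP[_ sa] ->; exists s.
elim/last_ind: [seq _ | _ <- _ & _] => [|cs c IH] H; first by left.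
rewrite foldl_rcons /=; case: ifP => _ /=.
  by right; apply: H; rewrite mem_rcons in_cons eqxx.
by apply: IH => c' h; apply: H; rewrite mem_rcons in_cons h orbT.
Qed.

Lemma arrangements_relabeling : all (fun s => is_relabeling s.2) arrangements.
Proof. by vm_compute. Qed.

Lemma valid_canonical m : valid_mono m -> valid_mono (canonical arrangements m).
Proof.
move=> vm; case: (canonicalP arrangements m) => [->//|[s sa ->]].
by apply: valid_relabel; move/allP: arrangements_relabeling; apply.
Qed.
Lemma sym_mono_val_canonical x m : valid_mono m -> sym_mono_val x (canonical arrangements m) = sym_mono_val x m.
Proof.
move=> vm; case: (canonicalP arrangements m) => [->//|[s sa ->]].
by apply: sym_mono_val_relabel => //; move/allP: arrangements_relabeling; apply.
Qed.

(** Merging terms keeps the value at every Gram matrix. Passing to canonical forms keeps only the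
    sum over ['S_5], and the last tree is zero at each permuted Gram matrix separately. *)
Lemma sym_zeroP x (q : poly) : unit_gram x -> valid q -> sym_zero q -> sym_poly_val x q = 0.
Proof.
move=> gx vq; rewrite /sym_zero; set q1 := hterms _ _ _ => hz.
have vq1 : valid q1 by apply: valid_hterms.
have -> : sym_poly_val x q = sym_poly_val x q1.
  apply: eq_bigr => s _; rewrite poly_val_hterms htree_val_hbuild ?mul1r //.
    by rewrite /mono_val big_nil mul1r.
  exact: unit_gram_permuted.
set q2 := [seq _ | _ <- _] in hz.
have vq2 : valid q2.
  by rewrite /q2 /valid all_map; apply: sub_all vq1 => t /= /valid_canonical.
have -> : sym_poly_val x q1 = sym_poly_val x q2.
  rewrite !sym_poly_valE /q2 big_map big_seq [RHS]big_seq; apply: eq_bigr => t /(allP vq1) vt /=.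
  by rewrite sym_mono_val_canonical.
rewrite /sym_poly_val big1 // => s _; rewrite -htree_val_hbuild ?hzeroP //.
exact: unit_gram_permuted.
Qed.

Definition gram p : 'I_5 -> 'I_5 -> R := fun i j => \sum_a p i 0 a * p j 0 a.
Definition vpoly_val p (y : vpoly) (a : 'I_3) : R :=
  \sum_(t <- y) zr t.1.1 * mono_val (gram p) t.1.2 * p (inord t.2) 0 a.
Definition valid_vpoly (y : vpoly) : bool :=
  all (fun t => valid_mono t.1.2 && (t.2 < 5)%N) y.

Lemma vpoly_val_vrelabel p l s y a : represents l s -> valid_vpoly y ->
  vpoly_val p (vrelabel l y) a = vpoly_val (fun i => p (s i)) y a.
Proof.
move=> ls /allP vy; rewrite /vpoly_val /vrelabel big_map; apply: eq_big_seq => t /vy /andP[vm vt] /=.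
by rewrite (mono_val_relabel _ ls) // -ls.
Qed.

Lemma poly_val_vdot p c y z :
  poly_val (gram p) (vdot c y z) = zr c * \sum_a vpoly_val p y a * vpoly_val p z a.
Proof.
rewrite /poly_val /vdot big_allpairs_dep /=.
have -> : \sum_a vpoly_val p y a * vpoly_val p z a =
   \sum_(t <- y) \sum_(u <- z) \sum_a (zr t.1.1 * mono_val (gram p) t.1.2 * p (inord t.2) 0 a) *
                  (zr u.1.1 * mono_val (gram p) u.1.2 * p (inord u.2) 0 a).
  rewrite /vpoly_val; under eq_bigr do rewrite big_distrlr /=.
  rewrite exchange_big /=; apply: eq_bigr => t _.
  by rewrite exchange_big.
rewrite mulr_sumr; apply: eq_bigr => t _; rewrite mulr_sumr; apply: eq_bigr => u _.
rewrite !zrM mono_val_cons mono_val_cat /= {1}/gram mulr_suml !mulr_sumr.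
by apply: eq_bigr => a _; ring.
Qed.

Lemma vpoly_val_flatten p ys a : vpoly_val p (flatten ys) a = \sum_(y <- ys) vpoly_val p y a.
Proof. by rewrite /vpoly_val big_flatten. Qed.

Lemma relabel_comp l l' i : (i < size l')%N ->
  nth 0%N [seq nth 0%N l j | j <- l'] i = nth 0%N l (nth 0%N l' i).
Proof. by move=> h; rewrite (nth_map 0%N). Qed.

Lemma subgroupH_relabeling : all is_relabeling subgroupH.
Proof. by vm_compute. Qed.
Lemma subgroupH_mul :
  all (fun l => perm_eq [seq [seq nth 0%N l j | j <- l'] | l' <- subgroupH] subgroupH) subgroupH.
Proof. by vm_compute. Qed.

Lemma vrelabel_comp l l' y : is_relabeling l' -> valid_vpoly y ->
  vrelabel l (vrelabel l' y) = vrelabel [seq nth 0%N l j | j <- l'] y.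
Proof.
case/and3P=> /eqP sl _ _ /allP vy; rewrite /vrelabel -map_comp; apply/eq_in_map => t /vy /andP[/allP vm vt] /=.
rewrite relabel_comp ?sl //; congr (_, _, _).
rewrite /relabel -map_comp; apply/eq_in_map => e /vm /andP[h1 h2] /=.
by rewrite !relabel_comp ?sl.
Qed.

Lemma valid_vrelabel l y : is_relabeling l -> valid_vpoly (vrelabel l y).
Proof.
move=> rl; apply/allP => t /mapP[u _ ->] /=; rewrite valid_relabel //=.
have := valid_relabel [:: (u.2, u.2)] rl.
by rewrite /= andbT => /andP[].
Qed.

(** Composition with an element of the subgroup permutes the subgroup, hence only the order of the
    summands of [vsum y]. *)
Lemma vpoly_val_vsum_subgroup p l s y a : l \in subgroupH -> represents l s -> valid_vpoly y ->
  vpoly_val (fun i => p (s i)) (vsum y) a = vpoly_val p (vsum y) a.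
Proof.
move=> lH ls vy; rewrite /vsum !vpoly_val_flatten !big_map.
rewrite -[RHS](perm_big _ (allP subgroupH_mul _ lH)) big_map.
apply: eq_big_seq => l' l'H; have rl' := allP subgroupH_relabeling _ l'H.
by rewrite -(vpoly_val_vrelabel _ _ ls) ?valid_vrelabel // vrelabel_comp.
Qed.

Lemma sum_pperm (F : ('I_5 -> 'rV[R]_3) -> R) p (t : 'S_5) :
  \sum_(s : 'S_5) F (fun i => p (s (t i))) = \sum_(s : 'S_5) F (fun i => p (s i)).
Proof.
rewrite [RHS](reindex_inj (mulgI t)) /=; apply: eq_bigr => s _.
by congr F; apply: boolp.funext => i; rewrite permM.
Qed.

(** The 12 summands of [vsum z] contribute equally: reindexing the sum over ['S_5] moves the
    relabeling away from [z], and [vsum y] does not notice it. *)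
Lemma sum_vsum p y z : valid_vpoly y -> valid_vpoly z ->
  \sum_(s : 'S_5) \sum_a vpoly_val (fun i => p (s i)) (vsum y) a * vpoly_val (fun i => p (s i)) (vsum z) a =
  12 * \sum_(s : 'S_5) \sum_a vpoly_val (fun i => p (s i)) (vsum y) a * vpoly_val (fun i => p (s i)) z a.
Proof.
move=> vy vz.
transitivity (\sum_(l <- subgroupH) \sum_(s : 'S_5) \sum_a
    vpoly_val (fun i => p (s i)) (vsum y) a * vpoly_val (fun i => p (s i)) z a); last first.
  by rewrite big_const_seq iter_addr_0 mulr_natl.
transitivity (\sum_(s : 'S_5) \sum_(l <- subgroupH) \sum_a
   vpoly_val (fun i => p (s i)) (vsum y) a * vpoly_val (fun i => p (s i)) (vrelabel l z) a).
  apply: eq_bigr => s _; rewrite [RHS]exchange_big; apply: eq_bigr => a _.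
  by rewrite {2}/vsum vpoly_val_flatten big_map mulr_sumr.
rewrite exchange_big; apply: eq_big_seq => l lH.
have [t lt] := relabelingP (allP subgroupH_relabeling _ lH).
rewrite -[RHS](sum_pperm (fun q => \sum_a vpoly_val q (vsum y) a * vpoly_val q z a) p t).
apply: eq_bigr => s _; apply: eq_bigr => a _.
rewrite (vpoly_val_vsum_subgroup (fun i => p (s i)) a lH lt vy).
by rewrite (vpoly_val_vrelabel _ a lt vz).
Qed.
End Squares.

(** * Positivity of the sum of squares *)

Section PositiveGram.
Variable R : realType.
Local Notation zr := (@zr R).
Implicit Types (x : 'I_5 -> 'I_5 -> R) (m : mono) (p : 'I_5 -> 'rV[R]_3).

Lemma sum_square_triangle (F : nat -> nat -> R) n : (forall k l, F k l = F l k) ->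
  \sum_(0 <= k < n) \sum_(0 <= l < n) F k l =
  \sum_(0 <= k < n) (F k k + 2 * \sum_(0 <= l < k) F k l).
Proof.
move=> FC; elim: n => [|n IH]; first by rewrite !big_nil.
rewrite big_nat_recr //= [in RHS]big_nat_recr //= -IH.
under eq_bigr do rewrite big_nat_recr //=.
rewrite big_split /= big_nat_recr //=.
have -> : \sum_(0 <= i < n) F i n = \sum_(0 <= i < n) F n i by apply: eq_bigr => i _.
by ring.
Qed.

(** Gershgorin's argument for a form given by its lower triangle: every off-diagonal term obeys
    [2 d a b >= - |d| (a^2 + b^2)]. The induction adds one row at a time. *)
Lemma diagonal_dominance (D : nat -> nat -> R) (g : nat -> R) n :
  \sum_(0 <= k < n) g k ^+ 2 * (2 * D k k - \sum_(0 <= l < k) `|D k l|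
       - \sum_(k.+1 <= l < n) `|D l k|)
  <= 2 * \sum_(0 <= k < n) (D k k * g k ^+ 2 + \sum_(0 <= l < k) D k l * (g k * g l)).
Proof.
elim: n => [|n IH]; first by rewrite !big_nil mulr0.
rewrite big_nat_recr //= [in leRHS]big_nat_recr //= (@big_geq _ _ _ n.+1) // subr0 mulrDr.
(* The new row lengthens the column sum of each earlier [k] by the one entry [D n k]. *)
have -> : \sum_(0 <= k < n) g k ^+ 2 * (2 * D k k - \sum_(0 <= l < k) `|D k l|
       - \sum_(k.+1 <= l < n.+1) `|D l k|) =
   \sum_(0 <= k < n) g k ^+ 2 * (2 * D k k - \sum_(0 <= l < k) `|D k l|
       - \sum_(k.+1 <= l < n) `|D l k|) - \sum_(0 <= k < n) g k ^+ 2 * `|D n k|.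
  rewrite -sumrB; apply: eq_big_nat => k /andP[_ kn].
  by rewrite (@big_nat_recr _ _ _ n) //=; ring.
have S2E : g n ^+ 2 * \sum_(0 <= l < n) `|D n l| = \sum_(0 <= l < n) g n ^+ 2 * `|D n l|.
  by rewrite mulr_sumr.
set S1 := \sum_(0 <= k < n) g k ^+ 2 * `|_|; set S2 := \sum_(0 <= l < n) _ * `|_| in S2E.
suff : - (S1 + S2) <= 2 * \sum_(0 <= l < n) D n l * (g n * g l).
  by move=> h; rewrite mulrN S2E; move: IH h; lra.
rewrite /S1 /S2 -big_split /= -sumrN mulr_sumr; apply: ler_sum => k _.
have : - `|D n k| <= D n k by rewrite lerNl ler_normr lexx orbT.
have : D n k <= `|D n k| by rewrite ler_norm.
move: (D n k) `|D n k| (g n) (g k) => d e a b de ed.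
have e0 : 0 <= e by lra.
have h1 := mulr_ge0 e0 (sqr_ge0 (a - b)); have h2 := mulr_ge0 e0 (sqr_ge0 (a + b)).
(* The sign of [a * b] decides whether [d >= -e] or [d <= e] is used, together with
   [e (a - b)^2 >= 0] or [e (a + b)^2 >= 0]. The products are supplied by hand because [lra] is
   linear. *)
have [ab|/ltW ab] := lerP 0 (a * b).
  have h3 : 0 <= (d + e) * (a * b) by apply: mulr_ge0; lra.
  by move: h1 h3; lra.
have h3 : 0 <= (e - d) * (- (a * b)) by apply: mulr_ge0; lra.
by move: h2 h3; lra.
Qed.

Lemma zr_zdot a b J : (size a <= J)%N ->
  zr (zdot a b) = \sum_(0 <= j < J) zr (nth 0%ZZ a j) * zr (nth 0%ZZ b j).
Proof.
elim: a b J => [|a s IH] b J.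
  move=> _; rewrite big1 ?/zdot => [|j _]; first by case: b.
  by rewrite nth_nil zr0 mul0r.
case: b => [|b t] sJ.
  by rewrite big1 // => j _; rewrite nth_nil zr0 mulr0.
case: J sJ => // J sJ; rewrite big_nat_recl //= -(IH t J sJ).
by rewrite /zdot /= zrD zrM.
Qed.

Lemma zr_zsum f i n : zr (zsum f (iota i n)) = \sum_(i <= k < i + n) zr (f k).
Proof.
elim: n i => [|n IH] i; first by rewrite addn0 big_geq.
by rewrite /= zrD IH addSnnS [RHS]big_ltn // addnS ltnS leq_addr.
Qed.

Lemma entry_mkseq (F : nat -> nat -> Z) n k l : (l <= k)%N -> (k < n)%N ->
  entry [seq [seq F k l | l <- iota 0 k.+1] | k <- iota 0 n] k l = F k l.
Proof.
move=> lk kn; rewrite /entry (nth_map 0%N) ?size_iota //.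
by rewrite nth_iota // (nth_map 0%N) ?size_iota // nth_iota.
Qed.

(** [L * L^T] contributes a sum of squares, one for each column of [L], and dominance handles the
    residue. With doubled off-diagonal entries the triangular sum is the full quadratic form. *)
Lemma psdP n mu M L : psd n mu M L -> forall g : nat -> R,
  0 <= \sum_(0 <= k < n) \sum_(0 <= l < k.+1) zr (entry M k l) * (g k * g l).
Proof.
case/andP=> mu0 dom g.
pose D k l := zr (entry (residue n mu M L) k l).
pose W k l := zr (zdot (nth [::] L k) (nth [::] L l)).
have WC k l : W k l = W l k.
  rewrite /W; congr zr; rewrite /zdot.
  elim: (nth _ _ k) (nth _ _ l) => [|a s IH] [|b t] //=.
  by rewrite IH Z.mul_comm.
have W0 : 0 <= \sum_(0 <= k < n) \sum_(0 <= l < n) W k l * (g k * g l).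
  (* The rows of [L] have different lengths; [J] is their common length after padding with 0. *)
  pose J := \max_(r <- L) size r.
  have sJ k : (size (nth [::] L k) <= J)%N.
    case: (ltnP k (size L)) => h; last by rewrite nth_default.
    by rewrite /J (big_nth [::]) big_mkord; apply: (@leq_bigmax _ (fun i : 'I_(size L) => size (nth [::] L i)) (Ordinal h)).
  have -> : \sum_(0 <= k < n) \sum_(0 <= l < n) W k l * (g k * g l) =
     \sum_(0 <= j < J) (\sum_(0 <= k < n) zr (nth 0%ZZ (nth [::] L k) j) * g k) ^+ 2.
    under [RHS]eq_bigr do rewrite expr2 big_distrlr /=.
    rewrite [RHS]exchange_big /=; apply: eq_bigr => k _.
    rewrite [RHS]exchange_big /=; apply: eq_bigr => l _.
    rewrite /W (zr_zdot _ (sJ k)) mulr_suml; apply: eq_bigr => j _; ring.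
  by apply: sumr_ge0 => j _; apply: sqr_ge0.
have Mrow k : (k < n)%N -> \sum_(0 <= l < k.+1) zr (entry M k l) * (g k * g l) =
    (D k k * g k ^+ 2 + \sum_(0 <= l < k) D k l * (g k * g l)) +
    zr mu * (W k k * (g k * g k) + 2 * \sum_(0 <= l < k) W k l * (g k * g l)).
  move=> kn; rewrite big_nat_recr //=.
  have -> : zr (entry M k k) = D k k + zr mu * W k k.
    by rewrite /D /W /residue (entry_mkseq (fun k l => _)) // eqxx zrB zrM; ring.
  have -> : \sum_(0 <= l < k) zr (entry M k l) * (g k * g l) =
     \sum_(0 <= l < k) D k l * (g k * g l) + zr mu * (2 * \sum_(0 <= l < k) W k l * (g k * g l)).
    rewrite !mulr_sumr -big_split /=; apply: eq_big_nat => l /andP[_ lk].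
    rewrite /D /W /residue (entry_mkseq (fun k l => _) (ltnW lk) kn) (ltn_eqF lk).
    by rewrite zrB !zrM -[zr 2%ZZ]/(2 : R); ring.
  by ring.
rewrite (eq_big_nat _ _ (fun k h => Mrow k (proj2 (andP h)))) big_split /=.
apply: addr_ge0; last first.
  rewrite -mulr_sumr -(@sum_square_triangle (fun k l => W k l * (g k * g l))).
    by apply: mulr_ge0 => //; exact: zr_ge0.
  by move=> k l; rewrite WC [g k * _]mulrC.
(* Twice the form is bounded, since a diagonal entry competes with halves of the stored off-diagonal
   ones. *)
rewrite -(pmulr_rge0 _ (ltr0n R 2)); apply: le_trans (diagonal_dominance D g n).
rewrite big_nat; apply: sumr_ge0 => k /andP[_ kn]; apply: mulr_ge0; first exact: sqr_ge0.
have := allP dom k; rewrite mem_iota add0n leq0n kn => /(_ isT) /(zr_le R).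
rewrite zrD !zr_zsum [zr (Z.mul _ _)]zrM -[zr 2%ZZ]/(2 : R) add0n subnKC //.
under eq_bigr do rewrite zr_abs.
under [X in _ + X]eq_bigr do rewrite zr_abs.
by rewrite -/(D k k); lra.
Qed.

Lemma gram_poly_ge0 p ys n mu M L : size ys = n -> all valid_vpoly ys -> psd n mu M L ->
  0 <= sym_poly_val (gram p) (gram_poly ys M).
Proof.
move=> sz vys pM; pose q s := fun i => p ((s : 'S_5) i).
pose Y k s a := vpoly_val (q s) (vsum (nth [::] ys k)) a.
have vk k : valid_vpoly (nth [::] ys k).
  by case: (ltnP k (size ys)) => h; [exact: (all_nthP [::] vys)|rewrite nth_default].
(* Summing the second factor over the subgroup as well costs the factor 12; then each pair [(s, a)]
   carries the form of [M] at one real vector [Y _ s a]. *)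
suff -> : sym_poly_val (gram p) (gram_poly ys M) = 12^-1 * \sum_(s : 'S_5) \sum_a
    \sum_(0 <= k < n) \sum_(0 <= l < k.+1) zr (entry M k l) * (Y k s a * Y l s a).
  apply: mulr_ge0; first by rewrite invr_ge0.
  by apply: sumr_ge0 => s _; apply: sumr_ge0 => a _; exact: (psdP pM).
rewrite /sym_poly_val mulr_sumr.
have E s : poly_val (permuted (gram p) s) (gram_poly ys M) = \sum_(0 <= k < n) \sum_(0 <= l < k.+1)
   zr (entry M k l) * \sum_a Y k s a * vpoly_val (q s) (nth [::] ys l) a.
  (* Permuting the Gram matrix is the same as permuting the points. *)
  rewrite -[permuted _ _]/(gram (q s)) /gram_poly poly_val_flatten big_map sz.
  rewrite -{1}(subn0 n) -/(index_iota 0 n); apply: eq_big_nat => k /andP[_ kn].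
  rewrite poly_val_flatten big_map -{1}(subn0 k.+1) -/(index_iota 0 k.+1); apply: eq_bigr => l _.
  by rewrite poly_val_vdot (nth_map [::]) ?sz.
under eq_bigr do rewrite E.
under [RHS]eq_bigr do rewrite exchange_big.
rewrite exchange_big -mulr_sumr [in RHS]exchange_big mulr_sumr /=; apply: eq_bigr => k _.
rewrite exchange_big; under [in RHS]eq_bigr do rewrite exchange_big.
rewrite [in RHS]exchange_big mulr_sumr /=; apply: eq_bigr => l _.
rewrite -mulr_sumr; under [in RHS]eq_bigr do rewrite -mulr_sumr.
by rewrite -mulr_sumr sum_vsum //; field.
Qed.
End PositiveGram.

(** * Vanishing of the 4 x 4 minors of the Gram matrix *)

Section GramMinors.
Variable R : realType.
Local Notation zr := (@zr R).
Implicit Types (x : 'I_5 -> 'I_5 -> R) (m : mono) (p : 'I_5 -> 'rV[R]_3).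

(** Each one is the determinant of a 4 x 3 matrix times a 3 x 4 matrix. In the coordinates of the
    five points this is a polynomial identity in 15 variables; indices from 2 on read the empty
    polynomial. *)
Lemma poly_val_minors p i : poly_val (gram p) (nth [::] minors i) = 0.
Proof.
case: i => [|[|i]]; last by rewrite nth_default // /poly_val big_nil.
all: rewrite poly_val_foldr.
all: vm_compute minors; rewrite /= !zr1 !zrN1 /gram !big_ord_recl !big_ord0.
all: move: (p (inord 0) 0) (p (inord 1) 0) (p (inord 2) 0) (p (inord 3) 0) (p (inord 4) 0) => a b c d e.
(* The three coordinate indices become variables, so that the coordinates are atoms for [ring]. *)
all: move: (lift _ (lift _ _)) => k; move: (lift _ _) => j; move: (@ord0 2) => i.
all: move: (a i) (a j) (a k) (b i) (b j) (b k) (c i) (c j) (c k) (d i) (d j) (d k) (e i) (e j) (e k).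
all: move=> *.
all: ring.
Qed.
End GramMinors.

(** * The bound and the equality case that a certificate yields *)

Section Certified.
Variable R : realType.
Local Notation zr := (@zr R).
Implicit Types (x : 'I_5 -> 'I_5 -> R) (m : mono) (p : 'I_5 -> 'rV[R]_3).


Lemma mono_val_nseq x k e : mono_val x (nseq k e) = x (inord e.1) (inord e.2) ^+ k.
Proof. by elim: k => [|k IH]; rewrite /= ?mono_val_cons ?IH ?exprS // /mono_val big_nil. Qed.

Lemma sum_all_pairs (F : 'I_5 -> 'I_5 -> R) :
  \sum_(e <- all_pairs) F (inord e.1) (inord e.2) = \sum_i \sum_j F i j.
Proof.
rewrite /all_pairs big_allpairs_dep -[iota 0 5]/(index_iota 0 5) big_mkord.
apply: eq_bigr => i _; rewrite big_mkord.
by apply: eq_bigr => j _; rewrite !inord_val.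
Qed.

Lemma poly_val_energy x phi C :
  poly_val x (energy_poly phi C) = zr C - \sum_i \sum_j zp_val phi (x i j).
Proof.
rewrite /energy_poly poly_val_cons {1}/mono_val big_nil mulr1; congr (_ + _).
rewrite poly_val_flatten big_map -(sum_all_pairs (fun i j => zp_val phi (x i j))) -sumrN.
apply: eq_bigr => e _; rewrite /poly_val big_map zp_valE /index_iota subn0 -sumrN.
by apply: eq_bigr => k _; rewrite /= mono_val_nseq zrN mulNr.
Qed.

Lemma poly_val_extra x e1 e2 : poly_val x (extra_poly e1 e2) =
  zr e2 * (x (inord 0) (inord 1) * (x (inord 0) (inord 2) - x (inord 1) (inord 2))) ^+ 2 +
  zr e1 * \sum_i \sum_j x i j.
Proof.
rewrite /extra_poly poly_val_cat; congr (_ + _).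
  by rewrite /poly_val /mono_val !big_cons !big_nil /= zrM -[zr (-2)%ZZ]/(-2 : R); ring.
rewrite /poly_val big_map -(sum_all_pairs x) mulr_sumr; apply: eq_bigr => e _ /=.
by rewrite /mono_val big_seq1.
Qed.

Lemma poly_val_ideal p I : poly_val (gram p) (ideal_poly I) = 0.
Proof.
rewrite /ideal_poly poly_val_flatten big_map big1 // => t _.
rewrite /poly_val big_map /=; under eq_bigr do rewrite zrM mono_val_cat mulrACA.
by rewrite -mulr_sumr [X in _ * X]poly_val_minors mulr0.
Qed.

Lemma sum_sum_permuted (F : R -> R) x (s : 'S_5) :
  \sum_i \sum_j F (permuted x s i j) = \sum_i \sum_j F (x i j).
Proof.
rewrite [RHS](reindex_inj (@perm_inj _ s)) /=; apply: eq_bigr => i _.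
by rewrite [RHS](reindex_inj (@perm_inj _ s)).
Qed.

(** Both sides are the squared norm of the sum of the points; thus the [e1] part of [extra_poly] is
    a square. *)
Lemma sum_gram p : \sum_i \sum_j gram p i j = \sum_a (\sum_i p i 0 a) ^+ 2.
Proof.
under [RHS]eq_bigr do rewrite expr2 big_distrlr /=.
by rewrite [RHS]exchange_big; apply: eq_bigr => i _; rewrite [RHS]exchange_big.
Qed.

Lemma valid_cat (q q' : poly) : valid (q ++ q') = valid q && valid q'.
Proof. exact: all_cat. Qed.
Lemma valid_mono_cat m m' : valid_mono (m ++ m') = valid_mono m && valid_mono m'.
Proof. exact: all_cat. Qed.
Lemma valid_flatten (T : eqType) (f : T -> poly) (s : seq T) :
  {in s, forall t, valid (f t)} -> valid (flatten [seq f t | t <- s]).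
Proof.
by move=> H; apply/allP => t /flattenP[q /mapP[u us ->]]; exact: (allP (H u us)).
Qed.
Lemma valid_vdot c y z : valid_vpoly y -> valid_vpoly z -> valid (vdot c y z).
Proof.
move=> /allP vy /allP vz; apply/allP => t /allpairsP[[u v] /= [/vy /andP[mu hu] /vz /andP[mv hv] ->]].
by rewrite /= hu hv /= valid_mono_cat mu.
Qed.
Lemma valid_vsum y : valid_vpoly (vsum y).
Proof.
apply/allP => t /flattenP[z /mapP[l lH ->]].
by move/allP: (valid_vrelabel y (allP subgroupH_relabeling _ lH)); apply.
Qed.
Lemma valid_gram_poly ys M : all valid_vpoly ys -> valid (gram_poly ys M).
Proof.
move=> vys; apply: valid_flatten => k; rewrite mem_iota add0n => /andP[_ hk].
apply: valid_flatten => l _; apply: valid_vdot.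
  by rewrite (nth_map [::]) // valid_vsum.
by case: (ltnP l (size ys)) => h; [exact: (all_nthP [::] vys)|rewrite nth_default].
Qed.
Lemma valid_minors i : valid (nth [::] minors i).
Proof. by case: i => [|[|i]]; [vm_compute|vm_compute|rewrite nth_default]. Qed.
Lemma valid_ideal_poly (I : seq (Z * mono * nat)) :
  all (fun t => valid_mono t.1.2) I -> valid (ideal_poly I).
Proof.
move=> /allP vI; apply: valid_flatten => t /vI vt; apply/allP => u /mapP[w wm ->] /=.
by rewrite valid_mono_cat vt (allP (valid_minors t.2)).
Qed.
Lemma valid_energy_poly phi C : valid (energy_poly phi C).
Proof.
suff: valid (flatten [seq [seq ((- nth 0%ZZ phi k)%ZZ, nseq k e) | k <- iota 0 (size phi)]
    | e <- all_pairs]) by [].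
apply: valid_flatten => e /allpairsP[[i j] []].
rewrite !mem_iota => /andP[_ hi] /andP[_ hj] ->.
by apply/allP => t /mapP[k _ ->] /=; apply/allP => e' /nseqP[-> _]; apply/andP.
Qed.

Lemma unit_gram_gram p : (forall i, gram p i i = 1) -> unit_gram (gram p).
Proof. by split=> // i j; apply: eq_bigr => a _; rewrite mulrC. Qed.

Definition certified (phi : seq Z) (C e1 e2 mu : Z) (ys : seq vpoly) (M L : seq (seq Z))
    (I : seq (Z * mono * nat)) : bool :=
  [&& (0 <? e1)%ZZ, (0 <? e2)%ZZ, all valid_vpoly ys, all (fun t => valid_mono t.1.2) I,
      psd (size ys) mu M L & sym_zero (total phi C e1 e2 ys M I)].

Lemma certified_bound phi C e1 e2 mu ys M L I : certified phi C e1 e2 mu ys M L I ->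
  forall p, (forall i, gram p i i = 1) ->
  zr C <= \sum_i \sum_j zp_val phi (gram p i j) /\
  (\sum_i \sum_j zp_val phi (gram p i j) = zr C ->
   (forall a, \sum_i p i 0 a = 0) /\
   forall s : 'S_5, gram p (s (inord 0)) (s (inord 1)) *
     (gram p (s (inord 0)) (s (inord 2)) - gram p (s (inord 1)) (s (inord 2))) = 0).
Proof.
case/and5P=> /(zr_gt0 R) e1p /(zr_gt0 R) e2p vys vI /andP[pM sz] p p1.
have gx := unit_gram_gram p1.
have vT : valid (total phi C e1 e2 ys M I).
  by rewrite /total !valid_cat valid_gram_poly // valid_ideal_poly // valid_energy_poly.
have := sym_zeroP gx vT sz; rewrite /total.
have A0 := gram_poly_ge0 p erefl vys pM.
pose Z2 (s : 'S_5) : R := gram p (s (inord 0)) (s (inord 1)) *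
     (gram p (s (inord 0)) (s (inord 2)) - gram p (s (inord 1)) (s (inord 2))).
(* The energy and the squared norm of the sum of the points are invariant under relabeling, so
   summation over ['S_5] multiplies them by [N]; the [e2] term is not invariant and remains a sum
   over [s]. *)
pose N : R := #|'S_5|%:R.
have N0 : 0 < N by rewrite ltr0n; apply/card_gt0P; exists 1%g.
have B0 : 0 <= \sum_(s : 'S_5) Z2 s ^+ 2 by apply: sumr_ge0 => s _; exact: sqr_ge0.
have C0 : 0 <= \sum_a (\sum_i p i 0 a) ^+ 2 by apply: sumr_ge0 => a _; exact: sqr_ge0.
have -> : sym_poly_val (gram p) (gram_poly ys M ++ ideal_poly I ++ extra_poly e1 e2 ++ energy_poly phi C) =
   sym_poly_val (gram p) (gram_poly ys M) + zr e2 * \sum_(s : 'S_5) Z2 s ^+ 2 +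
   N * (zr e1 * \sum_a (\sum_i p i 0 a) ^+ 2 + (zr C - \sum_i \sum_j zp_val phi (gram p i j))).
  have cat q q' : sym_poly_val (gram p) (q ++ q') = sym_poly_val (gram p) q + sym_poly_val (gram p) q'.
    by rewrite /sym_poly_val -big_split /=; apply: eq_bigr => s _; rewrite poly_val_cat.
  have I0 : sym_poly_val (gram p) (ideal_poly I) = 0.
    by apply: big1 => s _; exact: (poly_val_ideal (fun i => p (s i))).
  have X0 : sym_poly_val (gram p) (extra_poly e1 e2) = zr e2 * \sum_(s : 'S_5) Z2 s ^+ 2 +
      N * (zr e1 * \sum_a (\sum_i p i 0 a) ^+ 2).
    rewrite /sym_poly_val; under eq_bigr do rewrite poly_val_extra (sum_sum_permuted id).
    by rewrite big_split /= -mulr_sumr sumr_const mulr_natl sum_gram.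
  have Y0 : sym_poly_val (gram p) (energy_poly phi C) = N * (zr C - \sum_i \sum_j zp_val phi (gram p i j)).
    rewrite /sym_poly_val; under eq_bigr do rewrite poly_val_energy (sum_sum_permuted (zp_val phi)).
    by rewrite sumr_const mulr_natl.
  by rewrite (cat (gram_poly ys M)) (cat (ideal_poly I)) (cat (extra_poly e1 e2)) I0 X0 Y0; ring.
move: A0 B0 C0; set A := sym_poly_val _ _; set P := \sum_i \sum_j zp_val _ _.
set B := \sum_(s : 'S_5) _; set CC := \sum_a (\sum_i p i 0 a) ^+ 2 => A0 B0 C0 E.
(* The certified identity. Every term on the right is nonnegative, which gives the bound; at
   equality each of them is zero, and [e1] and [e2] are positive. *)
have H : N * (P - zr C) = A + zr e2 * B + N * (zr e1 * CC) by move: E; lra.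
have eB : 0 <= zr e2 * B by apply: mulr_ge0 => //; exact: ltW.
have eC : 0 <= N * (zr e1 * CC) by rewrite !mulr_ge0 // ltW.
split; first by rewrite -subr_ge0 -(pmulr_rge0 _ N0) H; lra.
move=> PC; have H0 : A + zr e2 * B + N * (zr e1 * CC) = 0 by rewrite -H PC subrr mulr0.
have eC0 : N * (zr e1 * CC) = 0 by lra.
have eB0 : zr e2 * B = 0 by lra.
move/eqP: eC0; rewrite !mulf_eq0 (gt_eqF N0) (gt_eqF e1p) /= => /eqP CC0.
move/eqP: eB0; rewrite mulf_eq0 (gt_eqF e2p) /= => /eqP BB0.
split=> [a|s].
  by move/psumr_eq0P: CC0 => /(_ (fun i _ => sqr_ge0 _)) /(_ a isT) /eqP; rewrite sqrf_eq0 => /eqP.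
by move/psumr_eq0P: BB0 => /(_ (fun i _ => sqr_ge0 _)) /(_ s isT) /eqP; rewrite sqrf_eq0 => /eqP.
Qed.
End Certified.

(** * Configurations on which the certificate is tight *)

(** The graph with the ten edge bits [e]. A loop has index 10 and reads the default [false]. *)
Definition supp (e : seq bool) (i j : nat) : bool := nth false e (edge_index i j).
(** Disjoint unions of complete graphs without isolated vertices: adjacent vertices have the same
    further neighbours. *)
Definition clustered (e : seq bool) : bool :=
  all (fun i => has (supp e i) (iota 0 5)) (iota 0 5) &&
  all (fun i => all (fun j => supp e i j ==>
    all (fun k => (k == i) || (k == j) || (supp e i k == supp e j k)) (iota 0 5)) (iota 0 5)) (iota 0 5).
(** In the order of [edges], the pattern is the edge 01 together with the triangle 234. *)
Definition two_three (e : seq bool) (s : seq nat) : bool :=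
  [seq supp e (nth 0 s i.1) (nth 0 s i.2) | i <- edges] ==
  [:: true; false; false; false; false; false; false; true; true; true].
Fixpoint bitseqs (n : nat) : seq (seq bool) :=
  if n is n'.+1 then [seq b :: e | b <- [:: true; false], e <- bitseqs n'] else [:: [::]].
Lemma mem_bitseqs n e : size e = n -> e \in bitseqs n.
Proof.
elim: n e => [|n IH] [|b e] // [/IH h].
by apply/allpairsP; exists (b, e); split=> //; case: b.
Qed.
(** 5 = 2 + 3 is the only way to split 5 into several parts of size at least 2; verified on all 1024
    graphs. *)
Lemma clustered_cases : all (fun e => clustered e ==>
  all id e || has (fun s => is_relabeling s.2 && two_three e s.2) arrangements) (bitseqs 10).
Proof. by vm_compute. Qed.

(** * The graph of nonzero inner products in the equality case *)

Section Clusters.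
Variable R : realType.
Implicit Types (x : 'I_5 -> 'I_5 -> R) (p : 'I_5 -> 'rV[R]_3).

Lemma distinct_perm (i j k : nat) : (i < 5)%N -> (j < 5)%N -> (k < 5)%N ->
  i != j -> k != i -> k != j ->
  exists s : 'S_5, [/\ s (inord 0) = inord i, s (inord 1) = inord j & s (inord 2) = inord k].
Proof.
move=> hi hj hk ij ki kj.
pose l := [:: i, j, k & [seq a <- iota 0 5 | a \notin [:: i; j; k]]].
have rl : is_relabeling l.
  by move: i j k hi hj hk ij ki kj @l => [|[|[|[|[|i]]]]] // [|[|[|[|[|j]]]]] // [|[|[|[|[|k]]]]].
by have [s hs] := relabelingP rl; exists s; split; rewrite hs.
Qed.

Section Gram.
Variable p : 'I_5 -> 'rV[R]_3.
Hypothesis p1 : forall i, gram p i i = 1.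
Hypothesis psum : forall a, \sum_i p i 0 a = 0.
Hypothesis pz : forall s : 'S_5, gram p (s (inord 0)) (s (inord 1)) *
     (gram p (s (inord 0)) (s (inord 2)) - gram p (s (inord 1)) (s (inord 2))) = 0.
Let X i j := gram p (inord i) (inord j).

Lemma gramC q (i j : 'I_5) : gram (q : 'I_5 -> 'rV[R]_3) i j = gram q j i.
Proof. by apply: eq_bigr => a _; rewrite mulrC. Qed.

Lemma rowsum i : \sum_(j < 5) gram p i j = 0.
Proof.
rewrite /gram exchange_big big1 //= => a _.
by rewrite -mulr_sumr psum mulr0.
Qed.

Lemma triple i j k : (i < 5)%N -> (j < 5)%N -> (k < 5)%N -> i != j -> k != i -> k != j ->
  X i j != 0 -> X i k = X j k.
Proof.
move=> hi hj hk ij ki kj; have [s [s0 s1 s2]] := distinct_perm hi hj hk ij ki kj.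
have := pz s; rewrite s0 s1 s2 => /eqP; rewrite mulf_eq0 subr_eq0 -/(X i j) => /orP[->//|/eqP].
by [].
Qed.

Lemma supp_gram i j : (i < 5)%N -> (j < 5)%N ->
  supp [seq X e.1 e.2 != 0 | e <- edges] i j = (i != j) && (X i j != 0).
Proof.
by move: i j => [|[|[|[|[|i]]]]] // [|[|[|[|[|j]]]]] // _ _; rewrite /supp /= // /X gramC.
Qed.

Lemma gram_clustered : clustered [seq X e.1 e.2 != 0 | e <- edges].
Proof.
apply/andP; split; apply/allP => i; rewrite mem_iota => /andP[_ hi].
  apply/negPn/negP => /hasPn h.
  (* At an isolated vertex only the diagonal entry 1 would be left in a row whose sum is 0. *)
  have := rowsum (inord i); rewrite (bigD1 (inord i)) //= p1 big1 ?addr0 => [/eqP|j ji].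
    by rewrite oner_eq0.
  have /h : nat_of_ord j \in iota 0 5 by rewrite mem_iota /= add0n.
  rewrite supp_gram // negb_and negbK => /orP[/eqP ij|].
    by move: ji; rewrite ij inord_val eqxx.
  by rewrite negbK /X inord_val => /eqP.
apply/allP => j; rewrite mem_iota => /andP[_ hj]; apply/implyP; rewrite supp_gram // => /andP[ij Xij].
apply/allP => k; rewrite mem_iota => /andP[_ hk].
have [//|ki] := eqVneq k i; have [//|kj] := eqVneq k j => /=.
rewrite !supp_gram // (triple hi hj hk) //.
by rewrite ![_ == k]eq_sym ki kj.
Qed.

(** If no inner product vanishes, all are equal, and the row sums force the value -1/4. That is the
    Gram matrix of the regular simplex, whose rank is 4. *)
Lemma not_simplex : ~ (forall i j, (i < 5)%N -> (j < 5)%N -> i != j -> X i j != 0).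
Proof.
move=> X0.
have tri i j k : (i < 5)%N -> (j < 5)%N -> (k < 5)%N -> i != j -> k != i -> k != j -> X i k = X j k.
  by move=> hi hj hk ij ki kj; apply: triple => //; apply: X0.
have XC i j : X i j = X j i by exact: gramC.
pose v := X 0 1.
(* [tri] exchanges one end of a pair at a time; at most two exchanges lead to the pair 01. *)
have Xv i j : (i < 5)%N -> (j < 5)%N -> i != j -> X i j = v.
  have X1 k : (k < 5)%N -> k != 1%N -> X k 1 = v.
    by move=> hk k1; have [->//|k0] := eqVneq k 0%N; apply: tri; rewrite // eq_sym.
  have X0k k : (k < 5)%N -> k != 0%N -> X k 0 = v.
    move=> hk k0; have [->|k1] := eqVneq k 1%N; first by rewrite XC.
    by rewrite (tri k 1%N 0%N) // 1?XC // eq_sym.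
  move=> hi hj ij.
  have [i0|i0] := eqVneq i 0%N; first by rewrite i0 XC X0k // -i0 eq_sym.
  have [j0|j0] := eqVneq j 0%N; first by rewrite j0 X0k.
  by rewrite (tri i 0%N j) // 1?eq_sym // XC X0k.
have v4 : v = - 4^-1.
  have := rowsum (inord 0); rewrite (bigD1 (inord 0)) //= p1.
  rewrite (eq_bigr (fun _ => v)) => [|j j0]; last first.
    by rewrite -[j]inord_val -/(X 0 j) Xv //; apply: contra j0 => /eqP jz; rewrite -[j]inord_val -jz.
  rewrite sumr_const (_ : #|_| = 4%N); last by rewrite cardC1 card_ord.
  by rewrite -mulr_natl; lra.
(* The principal minor would be [(1 - v)^3 (1 + 3 v) = (5/4)^3 / 4], not 0. *)
have := poly_val_minors p 0.
rewrite poly_val_foldr.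
vm_compute minors; rewrite /= !zr1 !zrN1 !p1 -![gram p _ _]/(X _ _) !Xv // v4; lra.
Qed.
End Gram.
End Clusters.

(** * Recovering an orthogonal matrix from the Gram matrix *)

Section Reconstruction.
Variable R : realType.
Implicit Types (p q : 'I_5 -> 'rV[R]_3).

Lemma sum3 (F : 'I_3 -> R) : \sum_i F i = F 0 + F 1 + F 2%:R.
Proof. by rewrite !big_ord_recl big_ord0 addr0 addrA; congr (F _ + F _ + F _); apply: val_inj. Qed.
Lemma sum5 (F : 'I_5 -> R) :
  \sum_i F i = F (inord 0) + F (inord 1) + F (inord 2) + F (inord 3) + F (inord 4).
Proof.
rewrite !big_ord_recl big_ord0 addr0 !addrA.
by congr (F _ + F _ + F _ + F _ + F _); apply: val_inj; rewrite /= inordK.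
Qed.

Definition gram_two_three q : Prop := forall i j, (i < j < 5)%N ->
  gram q (inord i) (inord j) = if (j < 2)%N then -1 else if (i < 2)%N then 0 else - 2^-1.

Lemma tbp_frame q : (forall i, gram q i i = 1) -> (forall a, \sum_i q i 0 a = 0) ->
  gram_two_three q ->
  exists Q : 'M[R]_3, Q *m Q^T = 1%:M /\ forall i, q i = tbp R i *m Q.
Proof.
move=> q1 qs qG; set s3 : R := Num.sqrt 3.
have s30 : s3 != 0 by rewrite gt_eqF // sqrtr_gt0.
have s32 : s3 ^+ 2 = 3 by rewrite sqr_sqrtr.
(* The rows are the images of the standard basis: in [tbp] the point 2 is the first basis vector,
   the points 3 and 4 differ by [sqrt 3] times the second, and the point 0 is the third. *)
pose Q := \matrix_(i < 3, a < 3)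
  (if i == 0 then q (inord 2) 0 a else if i == 1 then (q (inord 3) 0 a - q (inord 4) 0 a) / s3
   else q (inord 0) 0 a).
(* The poles are antipodal: [|q_0 + q_1|^2 = 1 + 1 - 2 = 0]. *)
have q01 a : q (inord 1) 0 a = - q (inord 0) 0 a.
  apply/eqP; rewrite -subr_eq0 opprK -sqrf_eq0; apply/eqP.
  have H : \sum_a (q (inord 1) 0 a + q (inord 0) 0 a) ^+ 2 = 0.
    have := qG 0%N 1%N isT; have := q1 (inord 0); have := q1 (inord 1).
    by rewrite /gram !sum3 /=; lra.
  by move/psumr_eq0P: H => /(_ (fun i _ => sqr_ge0 _)); apply.
have q234 a : q (inord 2) 0 a = - q (inord 3) 0 a - q (inord 4) 0 a.
  by have := qs a; rewrite sum5 q01; lra.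
exists Q; split.
  have g02 := qG 0%N 2%N isT; have g03 := qG 0%N 3%N isT; have g04 := qG 0%N 4%N isT.
  have g23 := qG 2%N 3%N isT; have g24 := qG 2%N 4%N isT; have g34 := qG 3%N 4%N isT.
  have g0 := q1 (inord 0); have g2 := q1 (inord 2); have g3 := q1 (inord 3); have g4 := q1 (inord 4).
  move: g02 g03 g04 g23 g24 g34 g0 g2 g3 g4; rewrite /gram !sum3 /= => g02 g03 g04 g23 g24 g34 g0 g2 g3 g4.
  (* [bb] serves for the norm of the middle row, [r0] for its orthogonality to any vector with equal
     inner products with [q_3] and [q_4]; they remove [sqrt 3] before [lra] is called. *)
  have bb u v : u / s3 * (v / s3) = u * v / 3 by rewrite -s32; field.
  have r0 v0 v1 v2 : q (inord 3) 0 0 * v0 + q (inord 3) 0 1 * v1 + q (inord 3) 0 2 * v2 =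
      q (inord 4) 0 0 * v0 + q (inord 4) 0 1 * v1 + q (inord 4) 0 2 * v2 ->
      (q (inord 3) 0 0 - q (inord 4) 0 0) / s3 * v0 + (q (inord 3) 0 1 - q (inord 4) 0 1) / s3 * v1 +
      (q (inord 3) 0 2 - q (inord 4) 0 2) / s3 * v2 = 0.
    move=> E; rewrite (_ : _ + _ = (q (inord 3) 0 0 * v0 + q (inord 3) 0 1 * v1 + q (inord 3) 0 2 * v2 -
      (q (inord 4) 0 0 * v0 + q (inord 4) 0 1 * v1 + q (inord 4) 0 2 * v2)) / s3); last by field.
    by rewrite E subrr mul0r.
  apply/matrixP => -[[|[|[|i]]] hi] // [[|[|[|j]]] hj] //; rewrite !mxE sum3 !mxE /=.
  all: rewrite ?bb.
  - by lra.
  - by rewrite ![_ * (_ / s3)]mulrC r0 //; lra.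
  - by lra.
  - by rewrite r0 //; lra.
  - by lra.
  - by rewrite r0 //; lra.
  - by lra.
  - by rewrite ![_ * (_ / s3)]mulrC r0 //; lra.
  - by lra.
case=> [[|[|[|[|[|i]]]]] hi] //.
all: apply/rowP => a; rewrite !mxE sum3 !mxE /= /vec3 /tbp /= ?mxE /= -?/s3.
all: match goal with |- context [@Ordinal _ ?k ?h] =>
  rewrite (_ : Ordinal h = inord k); last by apply: val_inj; rewrite /= inordK end.
- by ring.
- by rewrite q01; ring.
- by ring.
- by rewrite q234; field.
- by rewrite q234; field.
Qed.

Lemma tbp_unique p : (forall i, gram p i i = 1) -> (forall a, \sum_i p i 0 a = 0) ->
  (forall s : 'S_5, gram p (s (inord 0)) (s (inord 1)) *
     (gram p (s (inord 0)) (s (inord 2)) - gram p (s (inord 1)) (s (inord 2))) = 0) ->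
  exists Q : 'M[R]_3, Q *m Q^T = 1%:M /\ exists s : 'S_5, forall i, p i = tbp R (s i) *m Q.
Proof.
move=> p1 ps pz; set X := fun i j => gram p (inord i) (inord j).
set e := [seq X e.1 e.2 != 0 | e <- edges].
have se : size e = 10%N by [].
have := allP clustered_cases e (mem_bitseqs se); rewrite (gram_clustered p1 ps pz) implyTb.
have suppE i j : (i < 5)%N -> (j < 5)%N -> supp e i j = (i != j) && (X i j != 0).
  exact: supp_gram.
case/orP=> [/allP all_nz|/hasP[[s0 l] _ /andP[rl /eqP pat]]].
  case: (not_simplex p1 ps pz) => i j hi hj ij.
  have := suppE i j hi hj; rewrite ij andTb => <-; apply: all_nz; apply: mem_nth.
  by move: i j hi hj ij => [|[|[|[|[|i]]]]] // [|[|[|[|[|j]]]]].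
have [s ls] := relabelingP rl.
(* Renumbered so that the class of size 2 becomes 0, 1 and the class of size 3 becomes 2, 3, 4;
   [pat] then tells which inner products of [q] vanish. *)
pose q i := p (s i).
have lt5 i : (nth 0 l i < 5)%N.
  case/and3P: rl => /eqP sl al _.
  by case: (ltnP i 5) => h; [apply: (all_nthP 0%N al); rewrite sl|rewrite nth_default ?sl].
have Xq i j : (i < 5)%N -> (j < 5)%N -> gram q (inord i) (inord j) = X (nth 0 l i) (nth 0 l j).
  by move=> hi hj; rewrite /gram /q !ls.
have lij i j : (i < 5)%N -> (j < 5)%N -> i != j -> nth 0%N l i != nth 0%N l j.
  by case/and3P: rl => /eqP sl _ ul hi hj ij; rewrite nth_uniq ?sl.
have nz i j : (i < 5)%N -> (j < 5)%N -> i != j ->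
    supp e (nth 0 l i) (nth 0 l j) = (gram q (inord i) (inord j) != 0).
  by move=> hi hj ij; rewrite suppE // Xq // lij.
have q1 i : gram q i i = 1 by exact: p1.
have qs a : \sum_i q i 0 a = 0 by rewrite -[RHS](ps a) [RHS](reindex_inj (@perm_inj _ s)).
have nk k : (k < 10)%N ->
    (gram q (inord (nth (0, 0)%N edges k).1) (inord (nth (0, 0)%N edges k).2) != 0) =
    nth false [:: true; false; false; false; false; false; false; true; true; true] k.
  by rewrite -pat => hk; rewrite (nth_map (0, 0)%N) //; move: k hk =>
    [|[|[|[|[|[|[|[|[|[|k]]]]]]]]]] // _; rewrite nz.
have n02 := nk 1%N isT; have n03 := nk 2%N isT; have n04 := nk 3%N isT.
have n12 := nk 4%N isT; have n13 := nk 5%N isT; have n14 := nk 6%N isT.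
have n24 := nk 8%N isT; have n34 := nk 9%N isT.
have z0 i j : (gram q (inord i) (inord j) != 0) = false -> gram q (inord i) (inord j) = 0.
  by move/negbFE/eqP.
have tri i j k : (i < 5)%N -> (j < 5)%N -> (k < 5)%N -> i != j -> k != i -> k != j ->
    gram q (inord i) (inord j) != 0 -> gram q (inord i) (inord k) = gram q (inord j) (inord k).
  by move=> hi hj hk ij ki kj; rewrite !Xq //; apply: triple => //; rewrite lij.
have qC i j : gram q i j = gram q j i by exact: gramC.
have row i : \sum_j gram q i j = 0 by exact: rowsum.
(* Together these make the three inner products inside 2, 3, 4 equal. *)
have e2 := tri 3%N 4%N 2%N isT isT isT isT isT isT n34.
have e3 := tri 2%N 4%N 3%N isT isT isT isT isT isT n24.
have qG : gram_two_three q.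
  (* Row 0 now reads [1 + x_01 = 0], and row 2 reads [1 + 2 x_23 = 0]. *)
  have h0 := row (inord 0); have h2 := row (inord 2); move: h0 h2.
  rewrite !sum5 !q1 (qC (inord 2) (inord 0)) (qC (inord 2) (inord 1)).
  rewrite (z0 _ _ n02) (z0 _ _ n03) (z0 _ _ n04) (z0 _ _ n12) => h0 h2.
  move: e2 e3; rewrite (qC (inord 3)) (qC (inord 4) (inord 2)) (qC (inord 4) (inord 3)) => e2 e3.
  have h01 : gram q (inord 0) (inord 1) = -1 by lra.
  have h23 : gram q (inord 2) (inord 3) = - 2^-1 by lra.
  have h24 : gram q (inord 2) (inord 4) = - 2^-1 by lra.
  have h34 : gram q (inord 3) (inord 4) = - 2^-1 by lra.
  by move=> i j /andP[]; move: i j => [|[|[|[|i]]]] [|[|[|[|[|j]]]]] //= _ _; do [exact: h01|exact: h23|exact: h24|exact: h34|exact: z0].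
have [Q [QQ Qt]] := tbp_frame q1 qs qG.
exists Q; split=> //; exists (s^-1)%g => i.
by rewrite -Qt /q permKV.
Qed.
End Reconstruction.

(** * From certificates to energies *)

(** Lies below [K f] wherever [u >= 0], once [r] has nonnegative coefficients. It touches [K f] at
    the roots of [b]; [K] clears denominators. *)
Definition minorant (K : Z) (f b r : seq Z) : seq Z :=
  zpadd (zpscale K f) (zpscale (-1) (zpmul (zpmul b b) r)).
(* [kappa] is a common denominator and [E] is [2 K] times the energy of the bi-pyramid; [zpeval h 2]
   comes from the diagonal of the Gram matrix, where [u = 2]. *)
Definition energy_certificate (K : Z) (f b r : seq Z) (kappa E e1 e2 mu : Z)
    (ys : seq vpoly) (M L : seq (seq Z)) (I : seq (Z * mono * nat)) : bool :=
  let h := minorant K f b r in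
  let n := (2 ^ Z.of_nat (size f))%ZZ in
  [&& (0 <? kappa)%ZZ, (0 <? K)%ZZ, all (Z.leb 0) r,
      (E * n =? 2 * K * (n * zpeval f 0 + 3 * zphalf f + 6 * (n * zpeval f 1)))%ZZ &
      certified (zpscale kappa (zpshift h)) (kappa * (E + 5 * zpeval h 2)) e1 e2 mu ys M L I].

(** * Energies as sums over pairs of polynomials in [u] *)

Section Energy.
Variable R : realType.
Local Notation zr := (@zr R).
Implicit Types (p q : 'I_5 -> 'rV[R]_3) (a b : seq Z) (t : R).

Lemma sum_pairs (F : 'I_5 -> 'I_5 -> R) : (forall i j, F i j = F j i) ->
  \sum_i \sum_j F i j = 2 * (\sum_(i < 5) \sum_(j < 5 | (i < j)%N) F i j) + \sum_i F i i.
Proof.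
move=> FC.
have E i : \sum_j F i j = \sum_(j < 5 | (i < j)%N) F i j + (\sum_(j < 5 | (j < i)%N) F i j + F i i).
  rewrite (bigID (fun j : 'I_5 => (i < j)%N)) /=; congr (_ + _).
  rewrite (bigD1 i) ?ltnn //= addrC; congr (_ + _); apply: eq_bigl => j.
  by rewrite -leqNgt ltn_neqAle andbC.
under eq_bigr do rewrite E.
rewrite !big_split /= addrA; congr (_ + _).
rewrite (_ : \sum_(i < 5) \sum_(j < 5 | (j < i)%N) F i j =
   \sum_(i < 5) \sum_(j < 5 | (i < j)%N) F i j); first by ring.
rewrite (exchange_big_dep predT) //=; apply: eq_bigr => i _.
by apply: eq_bigr => j _; rewrite FC.
Qed.

Lemma gram_ge p i j : (forall i, gram p i i = 1) -> 0 <= 1 + gram p i j.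
Proof.
(* This sum is [|p_i + p_j|^2 = 2 (1 + x_ij)]. *)
move=> p1; suff: 0 <= \sum_a (p i 0 a + p j 0 a) ^+ 2.
  by have := p1 i; have := p1 j; rewrite /gram !sum3; lra.
by apply: sumr_ge0 => a _; exact: sqr_ge0.
Qed.

Definition pair_sum (f : seq Z) p : R :=
  \sum_(i < 5) \sum_(j < 5 | (i < j)%N) zp_val f (1 + gram p i j).
(** The ten pairs of the bi-pyramid: the antipodal poles, three equatorial pairs at 120 degrees, and
    six orthogonal pairs of a pole and an equatorial point. *)
Definition tbp_sum (f : seq Z) : R := zp_val f 0 + 3 * zp_val f 2^-1 + 6 * zp_val f 1.

Lemma energy_certificate_bound K f b r kappa E e1 e2 mu ys M L I :
  energy_certificate K f b r kappa E e1 e2 mu ys M L I ->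
  forall p, (forall i, gram p i i = 1) ->
  tbp_sum f <= pair_sum f p /\
  (pair_sum f p = tbp_sum f ->
   exists Q : 'M[R]_3, Q *m Q^T = 1%:M /\ exists s : 'S_5, forall i, p i = tbp R (s i) *m Q).
Proof.
case/and5P=> /(zr_gt0 R) k0 /(zr_gt0 R) K0 r0 /Z.eqb_eq EE ct p p1.
have Ef : zr E = 2 * zr K * tbp_sum f.
  have n0 : 2 ^+ size f != 0 :> R by rewrite expf_neq0 // pnatr_eq0.
  apply: (mulIf n0); have EE' := congr1 zr EE; move: EE'.
  rewrite !(zrM, zrD) !zr_zpeval zr_zphalf zr_pow2 -[zr 2%ZZ]/(2 : R) -[zr 3%ZZ]/(3 : R).
  by rewrite -[zr 6%ZZ]/(6 : R) zr0 zr1 /tbp_sum => ->; ring.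
pose h := minorant K f b r.
have hE t : zp_val h t = zr K * zp_val f t - zp_val b t ^+ 2 * zp_val r t.
  by rewrite /h /minorant zp_val_add !zp_val_scale !zp_val_mul -[zr (-1)%ZZ]/(-1 : R); ring.
have [le eq] := certified_bound ct p1.
have phE t : zp_val (zpscale kappa (zpshift h)) t = zr kappa * zp_val h (1 + t).
  by rewrite zp_val_scale zp_val_shift.
pose S := \sum_(i < 5) \sum_(j < 5 | (i < j)%N) zp_val h (1 + gram p i j).
have SE : \sum_i \sum_j zp_val (zpscale kappa (zpshift h)) (gram p i j) =
    zr kappa * (2 * S + 5 * zp_val h 2).
  under eq_bigr do under eq_bigr do rewrite phE.
  under eq_bigr do rewrite -mulr_sumr.
  rewrite -mulr_sumr; congr (_ * _).
  rewrite (@sum_pairs (fun i j => zp_val h (1 + gram p i j))); last by move=> i j; rewrite gramC.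
  congr (_ + _); under eq_bigr do rewrite p1.
  by rewrite sumr_const card_ord -[1 + 1]/(2 : R) mulr_natl.
have CE : zr (kappa * (E + 5 * zpeval h 2))%ZZ = zr kappa * (zr E + 5 * zp_val h 2).
  by rewrite zrM zrD zrM zr_zpeval -[zr 5%ZZ]/(5 : R) -[zr 2%ZZ]/(2 : R).
have hf : S <= zr K * pair_sum f p.
  rewrite /S /pair_sum mulr_sumr; apply: ler_sum => i _; rewrite mulr_sumr; apply: ler_sum => j _.
  rewrite hE gerBl mulr_ge0 ?sqr_ge0 // zp_val_ge0 //; exact: gram_ge.
move: le eq; rewrite SE CE ler_pM2l // => le eq.
have ES : zr E <= 2 * S by lra.
split.
  by rewrite -(ler_pM2l K0); lra.
(* [E <= 2 S <= 2 K * pair_sum f p], and the outer terms now agree; so the minorant attains its own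
   bound and the equality case of the certificate applies. *)
move=> ft; have S0 : 2 * S = zr E by move: hf; rewrite ft; lra.
have [] := eq _; first by rewrite S0.
exact: tbp_unique.
Qed.

Lemma gram_norm3 (p : 'I_5 -> 'rV[R]_3) : (forall i, norm3 (p i) = 1) -> forall i, gram p i i = 1.
Proof.
move=> h i; have := h i; rewrite /norm3 => /(congr1 (fun t => t ^+ 2)).
rewrite sqr_sqrtr ?expr1n; last by apply: sumr_ge0 => a _; exact: sqr_ge0.
by move=> E; rewrite -[RHS]E; apply: eq_bigr => a _; rewrite expr2.
Qed.

Lemma G_norm3 p k i j : (forall i, gram p i i = 1) ->
  G k (norm3 (p i - p j)) = 2 ^+ k * (1 + gram p i j) ^+ k.
Proof.
move=> p1; rewrite /G /norm3 sqr_sqrtr; last by apply: sumr_ge0 => a _; exact: sqr_ge0.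
rewrite -exprMn; congr (_ ^+ _); have := p1 i; have := p1 j.
by rewrite /gram !sum3 !mxE; lra.
Qed.

Lemma norm3_tbp i : norm3 (tbp R i) = 1.
Proof.
have s32 : Num.sqrt 3 ^+ 2 = 3 :> R by rewrite sqr_sqrtr.
rewrite -[RHS]sqrtr1 /norm3; congr Num.sqrt.
case: i => [[|[|[|[|[|i]]]]] hi] //; rewrite sum3 !mxE /=; lra.
Qed.

Lemma gram_tbp : gram_two_three (tbp R).
Proof.
have s32 : Num.sqrt 3 ^+ 2 = 3 :> R by rewrite sqr_sqrtr.
move=> i j /andP[]; move: i j => [|[|[|[|i]]]] [|[|[|[|[|j]]]]] // _ _.
all: rewrite /gram /tbp /= !inordK // sum3 !mxE /=; lra.
Qed.

Lemma pair_sum_tbp f : pair_sum f (tbp R) = tbp_sum f.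
Proof.
have h i j : (i < j < 5)%N -> zp_val f (1 + gram (tbp R) (inord i) (inord j)) =
   if (j < 2)%N then zp_val f 0 else if (i < 2)%N then zp_val f 1 else zp_val f 2^-1.
  move=> hij; rewrite gram_tbp //; case: ifP => _; first by rewrite subrr.
  case: ifP => _; first by rewrite addr0.
  by congr (zp_val f); lra.
rewrite /pair_sum !sum5.
do 5 rewrite big_mkcond sum5 /= ?inordK //=.
rewrite !h //= /tbp_sum; ring.
Qed.

(** [lam] takes up the power of 2 that separates the potential from its integer coefficient list
    [fs] in [u]. *)
Lemma energy_certificate_minimizer K b r kappa E e1 e2 mu ys M L I (f : R -> R) fs lam :
  energy_certificate K fs b r kappa E e1 e2 mu ys M L I -> 0 < lam ->
  (forall p i j, (forall i, gram p i i = 1) ->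
     f (norm3 (p i - p j)) = lam * zp_val fs (1 + gram p i j)) ->
  forall p, (forall i, norm3 (p i) = 1) ->
    energy f (@tbp R) <= energy f p /\
    (energy f p = energy f (@tbp R) ->
     exists Q : 'M[R]_3, Q *m Q^T = 1%:M /\
       exists s : 'S_5, forall i, p i = tbp R (s i) *m Q).
Proof.
move=> ct lam0 fE p /gram_norm3 p1.
have enE q : (forall i, gram q i i = 1) -> energy f q = lam * pair_sum fs q.
  move=> q1; rewrite /energy /pair_sum mulr_sumr; apply: eq_bigr => i _.
  by rewrite mulr_sumr; apply: eq_bigr => j _; exact: fE.
rewrite (enE p p1) (enE _ (gram_norm3 norm3_tbp)) pair_sum_tbp ler_pM2l //.
have [le eq] := energy_certificate_bound ct p1; split=> // /(mulfI (lt0r_neq0 lam0)).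
exact: eq.
Qed.
End Energy.

(** * The five certificates *)

(* [quintic] is the Hermite interpolant of [u^5] at [u = 0, 1/2, 1/2, 1, 1]; [sharp] has the
   further nodes [u = 0, 7/10, 7/10]. *)


Definition cube_vectors : seq vpoly := [::
  [:: (3%ZZ, [::(0,2)], 0); (1%ZZ, [::], 0); (1%ZZ, [::(0,1)], 0)];
  [:: (1%ZZ, [::(0,2)], 1); ((-1)%ZZ, [::(0,2)], 0)];
  [:: (3%ZZ, [::(2,3)], 2); ((-1)%ZZ, [::], 0); (3%ZZ, [::(0,2)], 2)];
  [:: (1%ZZ, [::(0,1);(0,2)], 3)];
  [:: (1%ZZ, [::(0,1);(2,3)], 2)];
  [:: (2%ZZ, [::(0,2);(0,2)], 0); ((-1)%ZZ, [::(0,1)], 0); ((-2)%ZZ, [::(0,2)], 2)];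
  [:: (6%ZZ, [::(0,2);(0,2)], 2); ((-1)%ZZ, [::], 0); (2%ZZ, [::(0,1)], 0); (9%ZZ, [::(0,2)], 2)];
  [:: (2%ZZ, [::(0,2);(0,3)], 0); ((-1)%ZZ, [::(2,3)], 2)];
  [:: (1%ZZ, [::(0,2);(0,3)], 4); (1%ZZ, [::(0,2);(0,3)], 1)];
  [:: (1%ZZ, [::(0,2);(1,3)], 4); (1%ZZ, [::(2,3)], 2)];
  [:: (2%ZZ, [::(0,2);(2,3)], 0); ((-1)%ZZ, [::(2,3)], 2)];
  [:: (1%ZZ, [::(0,2);(2,3)], 1); ((-1)%ZZ, [::(0,2);(0,3)], 1)];
  [:: (4%ZZ, [::(0,2);(2,3)], 2); (1%ZZ, [::(2,3)], 2)];
  [:: (2%ZZ, [::(0,2);(3,4)], 2); (1%ZZ, [::(2,3)], 4)];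
  [:: (2%ZZ, [::(2,3);(2,3)], 2); (1%ZZ, [::(2,3)], 2)];
  [:: (1%ZZ, [::(2,3);(2,4)], 0)];
  [:: (1%ZZ, [::(2,3);(2,4)], 3)]].

Definition cube_gram : seq (seq Z) := [::
  [:: 202807999152];
  [:: 293891355252; 565578973377];
  [:: 155109663720; 53271166014; 399906091134];
  [:: -125948164122; -380573274152; -426363311088; 2216609159612];
  [:: -115320615300; -305066946294; 680861380122; -1030577624604; 508892384286];
  [:: 179929988964; -76653514476; 391516784208; 44344218204; 248535231318; 171015717510];
  [:: -94264802676; -91008933246; -102109399326; 107625603096; -32370920010; -44057892186; 20134081638];
  [:: 54970338456; -380444119308; 311123897172; -44245377484; 337145753340; 339511406058; 5463349848;
   236646353295];
  [:: -42025977180; 55003809404; -247199839920; -190221925924; -246465523560; -198674633916; 2571524802;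
   -215285357826; 108328691354];
  [:: -8881175160; 177509514718; -76210251282; -513547204998; 101150897958; 38009346210; 51865583220;
   122960888721; -142285225302; 278358832620];
  [:: -180417457440; -461364730002; 58451599998; -378722166878; 356922360630; -172074067308; -16888851342;
   -127135290150; 127072327536; -375227420436; 391292699490];
  [:: -132030453456; -629946837394; -105082972632; 671182399396; -91581776218; -65031250086; 11550822228;
   4901087774; 141845404338; -524599185060; 489131290360; 364361915544];
  [:: -47296981512; 108697075740; -171934622244; -140287386192; -192684011454; -208913778612;
   -13682034432; -267778818054; 208835409222; -214572940956; 200115759690; 163956137598; 121240160118];
  [:: 118412401536; -157044088080; 144436764186; -716357784582; 254394288819; 151027457328; -20615841774;
   231896864034; -62306881263; 146028039498; 15659722584; -77708705580; -110024716428; 135545192046];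
  [:: -124943427576; 4554333036; -351811570572; -129036582180; -302054914656; -217331989776; 43179748722;
   -176417897931; 205081763832; -30713174415; 12109910274; 87844604562; 170090259174; -65560428846;
   132173676558];
  [:: -15052844466; 452894214762; -27730034244; -1529540497110; 286858197477; -52924273776; 32010030954;
   9616915638; -80731927870; 718964162492; -333286463268; -792667278748; -146927840103; 231918811542;
   22041178236; 591050550736];
  [:: 13992651882; 584608811241; -672524001864; 846922597926; -803609070660; -354136043250; 58911727446;
   -473196908892; 117868575996; 224561820336; -405855979650; -310867181134; 99821352510; -313065176787;
   191066987628; 206589659428; 562267887984]]%ZZ.

Definition cube_cholesky : seq (seq Z) := [::
  [:: 3013];
  [:: 2200; 4539];
  [:: 1161; -298; 4066];
  [:: -943; -1434; -2201; 9599];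
  [:: -863; -1098; 3943; -1766; 1507];
  [:: 1347; -1034; 1711; 475; -183; 1255];
  [:: -706; -110; -373; 82; 103; 368; 192];
  [:: 412; -2090; 1455; -42; -97; 1957; 105; 316];
  [:: -315; 426; -1250; -701; -1110; -1075; -91; -134; 264];
  [:: -66; 914; -337; -1154; 1671; 2648; 249; 343; -311; 354];
  [:: -1351; -1638; 590; -1132; 505; -3296; -222; -380; 118; -170; 302];
  [:: -988; -2651; -495; 971; -1435; -2194; -206; -277; 276; -236; 59; 217];
  [:: -354; 712; -801; -442; -992; -1675; -131; -207; 172; -126; 17; 32; 188];
  [:: 886; -1210; 459; -1672; 273; 812; 44; 99; -62; 43; 16; 2; -25; 193];
  [:: -935; 476; -1650; -702; -1217; -173; -17; -22; 125; -40; -67; 36; 31; -18; 200];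
  [:: -113; 2305; 47; -3250; 1975; 2521; 261; 333; -332; 311; -43; -102; -34; 5; -11; 211];
  [:: 105; 2854; -3551; 1613; 1293; 296; 103; 64; -237; 177; 30; -68; -21; -1; -33; 62; 228]]%ZZ.

Definition cube_minors : seq (Z * mono * nat) := [::
  ((-1017784768572)%ZZ, [::(0,1)], 0); (1279986566760%ZZ, [::(0,1)], 1);
   ((-3395169624132)%ZZ, [::(0,3)], 1); ((-1324853469324)%ZZ, [::], 0);
   (1243863386172%ZZ, [::(0,4)], 0); ((-438565479264)%ZZ, [::(3,4)], 1)].

(** [E = 2 * 4 * (3/8 + 6) = 51]. Empty [b] and [r] leave the potential as it is. The uniqueness
    terms have the small weight [e1 = e2 = kappa K / 1000], as also for [u^4] and [u^5]. *)
Lemma cube_certificate : energy_certificate 4 [:: 0; 0; 0; 1]%ZZ [::]%ZZ [::]%ZZ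
  49500000000 51 198000000 198000000 22166
  cube_vectors cube_gram cube_cholesky cube_minors.
Proof. by vm_compute. Qed.

(** * The potential [G 4], that is [u^4] *)

(** Two examples of how a vector, summed over the subgroup, vanishes at every labelled bi-pyramid.
    [(2 x_23^2 + x_23) p_2] is zero for [x_23 = 0] and [x_23 = -1/2], and for [x_23 = -1] the terms
    at 2 and 3 add up to [p_2 + p_3 = 0]. For [x_23 x_24 p_0], either 2, 3, 4 form the equator and
    [p_0 + p_1 = 0], or every path on 2, 3, 4 contains an orthogonal pair. *)
Definition quartic_vectors : seq vpoly := [::
  [:: (3%ZZ, [::(0,2)], 0); (1%ZZ, [::], 0); (1%ZZ, [::(0,1)], 0)];
  [:: (1%ZZ, [::(0,2)], 1); ((-1)%ZZ, [::(0,2)], 0)];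
  [:: (3%ZZ, [::(2,3)], 2); ((-1)%ZZ, [::], 0); (3%ZZ, [::(0,2)], 2)];
  [:: (3%ZZ, [::(0,1);(0,2)], 2); ((-1)%ZZ, [::(0,1)], 0)];
  [:: (1%ZZ, [::(0,1);(0,2)], 3)];
  [:: (1%ZZ, [::(0,1);(2,3)], 2)];
  [:: (2%ZZ, [::(0,2);(0,2)], 0); ((-1)%ZZ, [::(0,1)], 0); ((-2)%ZZ, [::(0,2)], 2)];
  [:: (6%ZZ, [::(0,2);(0,2)], 2); ((-1)%ZZ, [::], 0); (2%ZZ, [::(0,1)], 0); (9%ZZ, [::(0,2)], 2)];
  [:: (2%ZZ, [::(0,2);(0,3)], 0); ((-1)%ZZ, [::(2,3)], 2)];
  [:: (1%ZZ, [::(0,2);(0,3)], 4); (1%ZZ, [::(0,2);(0,3)], 1)];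
  [:: (1%ZZ, [::(0,2);(1,3)], 4); (1%ZZ, [::(2,3)], 2)];
  [:: (1%ZZ, [::(0,2);(2,3)], 1); ((-1)%ZZ, [::(0,2);(0,3)], 1)];
  [:: (4%ZZ, [::(0,2);(2,3)], 3); (1%ZZ, [::(2,3)], 2)];
  [:: (2%ZZ, [::(2,3);(2,3)], 2); (1%ZZ, [::(2,3)], 2)];
  [:: (1%ZZ, [::(2,3);(2,4)], 0)];
  [:: (1%ZZ, [::(2,3);(2,4)], 2)];
  [:: (1%ZZ, [::(2,3);(2,4)], 3)]].

Definition quartic_gram : seq (seq Z) := [::
  [:: 574641075711048];
  [:: 1265933652264144; 1248381558802116];
  [:: 771180543905328; 556864929267072; 1150779344332296];
  [:: -39447689751888; -17926264998672; 574845741237936; 186627207797016];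
  [:: 884173949660544; 834467926906160; -2260738349050368; -850049479339392; 4267067817038286];
  [:: -1051699106043288; -1490556323381808; 169706248058856; 27875175996984; -1538600717609712;
   1303681875491016];
  [:: 283998597246912; -172384053107784; 1074948312471408; 275544599487072; -489503899966248;
   393586753603800; 367352078193072];
  [:: -238523354827464; -330690506033736; -377430978495504; -128201560105680; 104376923429592;
   219475961096568; -148879281838848; 61008479670984];
  [:: 854378521818600; -182744429867232; 1800991562293104; 158827707787608; -271474448299524;
   516276615012036; 1254030542068872; -183853963590840; 1414322535855144];
  [:: -410487746590120; -281161320383232; -303186912246768; 372153121596168; -576150983411901;
   -771273261503508; -283767054898032; -74643624440952; -1297624145027070; 898571491172460];
  [:: -1387654659814704; -1267940673234984; -535962043311384; 103231017106224; -2209483039443396;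
   1695718948175028; -298462396267536; 244291151532480; -1086083712170328; 389503000273272;
   1047961740219552];
  [:: -99643957006368; -566882412387264; -1472163611368368; -318150544126608; 3271723201090266;
   -931318194832680; -420085500572424; 154895806204488; -693561035934672; 694021800391901;
   -611603920526928; 1083215670136608];
  [:: -83465490692832; 136404602830440; -1068729162784152; -302465339260104; 1993901195081832;
   -322350683311128; -462453290469408; 117301534830600; -734158649658552; 8452141971264;
   -145822348786968; 869394241712952; 338992117188768];
  [:: -413533291579704; -405796511147184; -925284463288032; -21173680006776; 1808735767409088; 0;
   -232661755854522; 86736794238456; -696088135470936; 440262562782480; 165652613718120;
   1013162044833840; 562980055398672; 446637845516544];
  [:: -821272916125512; 356411505405600; -890256254819400; -400498046981856; -3953298459014544;
   326189611712000; -1326370161564576; 277938331259472; -2407360386739272; 385579670592216;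
   1911319262755274; -1402904320256544; -170704945207344; -959742910410648; 3058610387902430];
  [:: 285444785331144; 281136056140312; -259516400056752; -466392905441400; 1015389020790744;
   372262763285664; -58880455351848; 130009485362016; 620280391493520; -1371166751460240;
   -344654323866624; -219199592899380; 242181115945752; -224176708424424; 24554653990104;
   603083958474672];
  [:: 425104411964016; 2253963052260684; -739966078826616; -187533137763486; -816586876082700;
   -1950930629693280; -1292600714179800; -94825149666882; -2384433838928052; 760552195453698;
   -132920181830868; -464116820394132; 347617430413392; -423953040116976; 3638867666080200;
   -200584194260520; 2317524439647168]]%ZZ.

Definition quartic_cholesky : seq (seq Z) := [::
  [:: 2056];
  [:: 2282; 2004];
  [:: 1390; -553; 2502];
  [:: -71; 48; 901; 729];
  [:: 1594; -271; -4294; 1162; 3032];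
  [:: -1895; -598; 1172; -1453; 1279; 746];
  [:: 512; -902; 1108; 139; 569; 87; 192];
  [:: -430; -122; -347; -256; -51; 33; 25; 174];
  [:: 1540; -2091; 1350; -574; 803; 182; 436; 407; 720];
  [:: -740; 322; 33; 1757; -913; -516; -517; -631; -1001; 348];
  [:: -2501; 503; 707; -626; -100; 313; -202; -196; -338; 30; 181];
  [:: -180; -844; -2267; 1224; 338; -391; -212; -253; -416; 161; -24; 194];
  [:: -150; 424; -1406; 158; 502; 12; -27; 0; -12; -26; 5; -1; 153];
  [:: -745; 98; -935; 969; 916; -29; -46; -83; -117; 11; 15; -20; 18; 192];
  [:: -1480; 2345; 22; -2361; -2908; 92; -489; -324; -637; 67; 43; 58; -19; -206; 326];
  [:: 514; -66; -685; -1469; 558; 360; 384; 503; 782; -233; -12; -30; 11; -23; 15; 180];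
  [:: 766; 3296; -793; -114; -2185; -329; -228; -108; -219; -60; -1; -38; 12; -42; 79; 15; 204]]%ZZ.

Definition quartic_minors : seq (Z * mono * nat) := [::
  ((-2607363750982032)%ZZ, [::(0,1)], 0); ((-5204151356752800)%ZZ, [::(0,1)], 1);
   ((-2254831539773904)%ZZ, [::(0,3)], 1); ((-2927604552845760)%ZZ, [::], 0);
   (39101824343088%ZZ, [::(0,4)], 0); ((-1359842142372048)%ZZ, [::(3,4)], 1)].

Lemma quartic_certificate : energy_certificate 8 [:: 0; 0; 0; 0; 1]%ZZ [::]%ZZ [::]%ZZ
  38229000000000 99 305832000000 305832000000 134936532
  quartic_vectors quartic_gram quartic_cholesky quartic_minors.
Proof. by vm_compute. Qed.

(** * The potential [G 5], that is [u^5] *)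

Definition quintic_vectors : seq vpoly := [::
  [:: (3%ZZ, [::(0,2)], 0); (1%ZZ, [::], 0); (1%ZZ, [::(0,1)], 0)];
  [:: (1%ZZ, [::(0,2)], 1); ((-1)%ZZ, [::(0,2)], 0)];
  [:: (3%ZZ, [::(2,3)], 2); ((-1)%ZZ, [::], 0); (3%ZZ, [::(0,2)], 2)];
  [:: (3%ZZ, [::(0,1);(0,2)], 2); ((-1)%ZZ, [::(0,1)], 0)];
  [:: (1%ZZ, [::(0,1);(0,2)], 3)];
  [:: (1%ZZ, [::(0,1);(2,3)], 2)];
  [:: (2%ZZ, [::(0,2);(0,2)], 0); ((-1)%ZZ, [::(0,1)], 0); ((-2)%ZZ, [::(0,2)], 2)];
  [:: (6%ZZ, [::(0,2);(0,2)], 2); ((-1)%ZZ, [::], 0); (2%ZZ, [::(0,1)], 0); (9%ZZ, [::(0,2)], 2)];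
  [:: (2%ZZ, [::(0,2);(0,3)], 0); ((-1)%ZZ, [::(2,3)], 2)];
  [:: (4%ZZ, [::(0,2);(0,3)], 2); (1%ZZ, [::(2,3)], 2)];
  [:: (1%ZZ, [::(0,2);(0,3)], 4); (1%ZZ, [::(0,2);(0,3)], 1)];
  [:: (3%ZZ, [::(0,2);(1,2)], 2); ((-1)%ZZ, [::(0,1)], 0)];
  [:: (1%ZZ, [::(0,2);(1,2)], 3)];
  [:: (1%ZZ, [::(0,2);(1,3)], 4); (1%ZZ, [::(2,3)], 2)];
  [:: (2%ZZ, [::(0,2);(2,3)], 0); ((-1)%ZZ, [::(2,3)], 2)];
  [:: (4%ZZ, [::(0,2);(2,3)], 3); (1%ZZ, [::(2,3)], 2)];
  [:: (1%ZZ, [::(0,2);(2,3)], 4); (1%ZZ, [::(0,2);(0,3)], 1)];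
  [:: (2%ZZ, [::(0,2);(3,4)], 2); (1%ZZ, [::(2,3)], 4)];
  [:: (2%ZZ, [::(0,2);(3,4)], 3); (1%ZZ, [::(2,3)], 2)];
  [:: (1%ZZ, [::(2,3);(2,4)], 0)];
  [:: (1%ZZ, [::(2,3);(2,4)], 2)];
  [:: (1%ZZ, [::(2,3);(2,4)], 3)]].

Definition quintic_gram : seq (seq Z) := [::
  [:: 940718047822092];
  [:: 2036047937294952; 1686990781331424];
  [:: 383219797062996; 712189449401004; 1329814567017540];
  [:: 855138082585068; 901367515830276; 1855799778232440; 816150677572620];
  [:: 169573541239368; -825540531705324; -4867642138797684; -3468571093909224; 11942898638226384];
  [:: -1396530303158124; -1763248866035112; 310314262348224; -317272989828348; -2537743246012608;
   904810927815594];
  [:: 957350077416792; 634116732472908; 1321174811054232; 1192646903581080; -1374581311405932;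
   -286527536628696; 667861925728248];
  [:: 118510991782056; -289807953211008; -516774169887624; -271720516257180; 785527738292736;
   46889273845296; 0; 139844257367904];
  [:: 1114978310849880; 2186186177684682; 1574823563959320; 1260018242567316; -1018566177788508;
   -788598265417092; 535238945900028; -492788882925936; 1698096795191892];
  [:: -1264678233505236; -717760601444988; 975645773777772; -55743363314712; -1029947398934364;
   1395823465828296; -363445195214052; -407339411446152; 1157969119220748; 1327394821980420];
  [:: -3410948594526516; -4215674834003700; 39958965802908; -1024618976702892; -85146661454784;
   2752857064856568; -1037207907470892; -209642445542592; -2079397640083500; 2465009110187928;
   3439994184201852];
  [:: 133638366939732; -269065755942804; -454955701640004; -396434588718672; 1251964362173652;
   254086626720008; 181693659130524; 334209641126904; -636094264882084; -176303030138352;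
   -104663839548708; 339024291455052];
  [:: -38374331244984; 1114709413836060; -1699369159600224; -836938173334720; 8104812708949020;
   -2827730127687936; -1536281507426004; -684993588789672; 571252722826140; -1221123325117428;
   -720848990206260; -1602668649305556; 5400394055336484];
  [:: -17347432598388; -1100812249774656; -552220232644188; -57743312441472; -4130374339236804;
   781820457525900; 122306334473952; 606680529296940; -1944885302970948; -1376591249340360;
   -74804531627664; 484693897211172; -3266484202921932; 1625076390282408];
  [:: 2045893260044592; 311046097094856; 1103206957269192; 1693939643062416; 1331133776437344;
   -1405395726508152; 2695263896061216; 449857451740176; -1448669673240264; -3015492182631324;
   -2064645060009948; 743597669493532; -1018695590648640; 1243415146964472; 4419670155445656];
  [:: -1222909504859340; -825951591469296; -1410988313743812; -1444233832462512; 4186541978516880;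
   -12776047879932; -1290152765188224; -164083029739416; -1027497624235560; 361723422069720;
   1817496074969208; -162213480428364; 3255382802109960; -1176289668781758; -1700501411865816;
   1154816808203664];
  [:: 2484579133815984; 2541185608323312; -856791661258188; 187581596182452; -6431386562846088;
   -685905526497588; 641367287455656; 869535874288404; -900624786675804; -3027778623296784;
   -5658114335647020; 1062088666100892; -5024248956574488; 4077925684020720; 1643832501812856;
   -2622284925976296; 5593133174539104];
  [:: 161798806927872; 605143252128708; 537099403181400; 554952395052459; -2800041489835884;
   -328848320476512; 0; -281141681188140; 346188564895464; -322009180094556; -535009126203180;
   -601104142962972; 959084368860348; 148660962356196; -195661701841788; -185409868591512;
   472746751673274; 404874007047936];
  [:: 579198449608596; 1267844806168668; -757002612084624; -187623619675812; 344130351279288;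
   -1011558083463828; -750403822764528; -75974885917740; 1102871471287428; -505446957236124;
   -1943597363835246; -571828638233052; 2354884905401748; -299332719129384; -1986305615692560;
   145112137350444; 983447872438680; 554789835195840; 960427000118412];
  [:: -1480158306396792; -2614695083705952; -1439952448085748; -1367626320192816; 2811720544055376;
   879751828387728; -460754823346344; 378636862256784; -3565182640628952; -752421202530120;
   3083728921867908; 674126095783428; 90071609173056; 1157559168288528; 1888047609085152;
   1600336278862488; -974303540000964; -602599323467304; -1685013851184480; 2116128459505464];
  [:: 3161927221629840; 2772055984617654; -855223437200148; 300106559430792; 4451991894208584;
   -1895727746634264; 1087193471765940; 851280433998192; 2056645796467680; -1603496650440672;
   -5905394846471700; 1119576598723656; -1910684239011840; 207188504843688; 1884399864118272;
   -2213328671716716; 4757052515089284; -1006193959201584; 1266167814811020; -2870483138012208;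
   4334381759074932];
  [:: 607491358014420; 910470677345784; -1962090777640716; -842524932349894; 2642765869011600;
   -2045994792430032; -671062203102744; 45309110243400; -2236797610101924; -3217007203601892;
   -1909805773164372; -351644614487280; 5265120724084020; 569567270121660; 2193541330640724;
   1704999356965512; 1975586247297384; 922386202381944; 998185126734396; 2148700173380568;
   -1209099339153792; 3350326503946896]]%ZZ.

Definition quintic_cholesky : seq (seq Z) := [::
  [:: 157816];
  [:: 170807; 124465];
  [:: 32149; 31637; 182138];
  [:: 71739; -2570; 122680; 37472];
  [:: 14226; -107336; -337690; -154528; 408159];
  [:: -117157; -26780; 47887; -46421; -63231; 32650];
  [:: 80313; -42765; 89287; -27628; 4779; -24058; 8052];
  [:: 9942; -44471; -31594; -14651; -18247; 8382; 586; 2617];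
  [:: 93537; 104183; 79866; 11783; 61636; 120297; -21926; 1557; 9296];
  [:: -106096; 69250; 77617; -65940; 27752; 88255; -11275; 336; 4635; 3555];
  [:: -286149; -55734; 63093; -24575; 35451; -15046; 2778; -1717; -2030; 966; 3576];
  [:: 11211; -44006; -27405; -74826; -22356; -2321; 6684; 677; -1335; 676; -901; 2871];
  [:: -3219; 122991; -144321; 191389; 248407; -92446; -7295; -4253; -2311; -2466; 3513; -4180; 5733];
  [:: -1455; -115097; -19891; 39612; -165653; -17920; 5582; 1602; -1520; -1448; -1307; 589; -1183; 2983];
  [:: 171633; -202451; 85062; -22461; 45828; -188012; 35242; -1492; -11068; -2003; 360; 854; -390; -61;
   4422];
  [:: -102592; 52933; -93649; -3632; 74438; -53539; 4945; -2386; -3789; 459; 1453; -680; 1458; -843; -136;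
   2666];
  [:: 208435; -15734; -96337; -18446; -306704; -22021; 13207; 2520; -3314; -828; -4341; 2198; -2005; 567;
   -338; 490; 3099];
  [:: 13574; 45742; 28700; 79264; -25515; -25934; -1061; -935; -800; -788; 618; -987; 1052; 67; -76; 99;
   -86; 2256];
  [:: 48590; 68181; -75445; 92364; -52; 61967; -17687; 1049; 5340; -1101; -352; -1285; 843; 833; -1217;
   -603; -99; 110; 2565];
  [:: -124173; -107722; -64040; -43207; -2138; -148828; 27297; -2637; -10952; -265; 1138; 471; 201; -356;
   1175; 1060; 703; 218; -744; 2626];
  [:: 265258; -69157; -96973; -89058; 3030; 147860; -15754; 5513; 9531; -128; -4252; 1902; -3073; 950;
   -687; -1304; 190; -354; 1022; -1708; 2633];
  [:: 50963; 26909; -156292; 118287; 6499; -214705; 24810; -4337; -12627; -2507; 1579; -1638; 3221; -279;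
   1117; 1288; 1002; 407; -526; 1122; -277; 2753]]%ZZ.

Definition quintic_minors : seq (Z * mono * nat) := [::
  ((-5651329856104836)%ZZ, [::(0,1)], 0); ((-6130834331507136)%ZZ, [::(0,1)], 1);
   ((-4665560570849160)%ZZ, [::], 0); ((-13715469593148924)%ZZ, [::(0,3)], 1);
   (2087080975421244%ZZ, [::(0,4)], 0); ((-618735673164780)%ZZ, [::(3,4)], 1)].

(** [b = (1 - u) (1 - 2 u)], and [r = 4 u] makes the leading terms of [16 u^5] and [b^2 r] cancel.
    The node 0 may stay simple, inside [r], because it is the end of the range of [u]. *)
Lemma quintic_certificate : energy_certificate 16 [:: 0; 0; 0; 0; 0; 1]%ZZ [:: 1; -3; 2]%ZZ [:: 0; 4]%ZZ
  29504250000000 195 472068000000 472068000000 37766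
  quintic_vectors quintic_gram quintic_cholesky quintic_minors.
Proof. by vm_compute. Qed.

(** * The potential [G 6], that is [u^6] *)

(** Coefficients of degree 3 give squares of degree 7 in the inner products; in the previous
    certificates the degree was at most 2, with squares of degree 5. *)
Definition sextic_vectors : seq vpoly := [::
  [:: (1%ZZ, [::(0,2)], 1); ((-1)%ZZ, [::(0,2)], 0)];
  [:: (3%ZZ, [::(2,3)], 2); ((-1)%ZZ, [::], 0); (3%ZZ, [::(0,2)], 2)];
  [:: (2%ZZ, [::(0,1);(0,1)], 0); (1%ZZ, [::(0,1)], 0)];
  [:: (2%ZZ, [::(0,2);(0,2)], 0); ((-1)%ZZ, [::(0,1)], 0); ((-2)%ZZ, [::(0,2)], 2)];
  [:: (2%ZZ, [::(0,2);(0,3)], 0); ((-1)%ZZ, [::(2,3)], 2)];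
  [:: (4%ZZ, [::(0,2);(0,3)], 2); (1%ZZ, [::(2,3)], 2)];
  [:: (1%ZZ, [::(0,2);(0,3)], 4); (1%ZZ, [::(0,2);(0,3)], 1)];
  [:: (1%ZZ, [::(0,2);(1,3)], 4); (1%ZZ, [::(2,3)], 2)];
  [:: (2%ZZ, [::(0,2);(2,3)], 0); ((-1)%ZZ, [::(2,3)], 2)];
  [:: (4%ZZ, [::(0,2);(2,3)], 2); (1%ZZ, [::(2,3)], 2)];
  [:: (2%ZZ, [::(0,2);(3,4)], 2); (1%ZZ, [::(2,3)], 4)];
  [:: (2%ZZ, [::(0,2);(3,4)], 3); (1%ZZ, [::(2,3)], 2)];
  [:: (2%ZZ, [::(2,3);(2,3)], 2); (1%ZZ, [::(2,3)], 2)];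
  [:: (1%ZZ, [::(2,3);(2,4)], 0)];
  [:: (1%ZZ, [::(2,3);(2,4)], 2)];
  [:: (1%ZZ, [::(2,3);(2,4)], 3)];
  [:: (1%ZZ, [::(0,1);(0,2);(1,3)], 2)];
  [:: (1%ZZ, [::(0,1);(0,2);(1,3)], 4)];
  [:: (1%ZZ, [::(0,1);(0,2);(2,3)], 3)];
  [:: (4%ZZ, [::(0,2);(0,2);(0,2)], 2); (1%ZZ, [::], 0); ((-2)%ZZ, [::(0,1)], 0); ((-7)%ZZ, [::(0,2)], 2)];
  [:: (4%ZZ, [::(0,2);(0,2);(0,3)], 0); (1%ZZ, [::(2,3)], 2)];
  [:: (2%ZZ, [::(0,2);(0,2);(0,3)], 4); ((-1)%ZZ, [::(0,2);(0,3)], 1)];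
  [:: (4%ZZ, [::(0,2);(0,2);(2,3)], 0); (1%ZZ, [::(2,3)], 2)];
  [:: (1%ZZ, [::(0,2);(0,3);(1,2)], 3)];
  [:: (1%ZZ, [::(0,2);(0,3);(1,4)], 1); (1%ZZ, [::(0,2);(0,3)], 1)];
  [:: (1%ZZ, [::(0,2);(0,3);(1,4)], 4); ((-1)%ZZ, [::(0,2);(0,3)], 1)];
  [:: (4%ZZ, [::(0,2);(0,3);(2,3)], 0); (1%ZZ, [::(2,3)], 2)];
  [:: (1%ZZ, [::(0,2);(0,3);(2,4)], 0)];
  [:: (1%ZZ, [::(0,2);(0,3);(2,4)], 1)];
  [:: (1%ZZ, [::(0,2);(0,3);(2,4)], 2)];
  [:: (1%ZZ, [::(0,2);(0,3);(2,4)], 4)];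
  [:: (1%ZZ, [::(0,2);(1,3);(2,3)], 2)];
  [:: (1%ZZ, [::(0,2);(2,3);(3,4)], 0)];
  [:: (1%ZZ, [::(0,2);(2,3);(3,4)], 3)];
  [:: (1%ZZ, [::(0,2);(2,3);(3,4)], 4)];
  [:: (1%ZZ, [::(2,3);(2,3);(2,4)], 2)];
  [:: (1%ZZ, [::(2,3);(2,3);(2,4)], 3)];
  [:: (1%ZZ, [::(2,3);(2,3);(2,4)], 4)];
  [:: (1%ZZ, [::(2,3);(2,4);(3,4)], 2)]].

Definition sextic_gram : seq (seq Z) := [::
  [:: 17205616071048585167703936];
  [:: -30217402692367741668578112; 21962996880035362638524928];
  [:: 28916334786783547334227392; -26211254552917602476812416; 17762763042875264831442432];
  [:: -36933371088859222365917232; 37751742876997809514033344; -33982763966865972416201472;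
   25623047535422175950417856];
  [:: -18981377303263825581039744; 12899269300518628263086400; -20408399749807246900806336;
   30171549740117812143074496; 22945513249463520086840304];
  [:: -5851322166956214221133696; -10381720974808776178760064; -17070948474904221367250880;
   16219199891045485374809472; 33326484775371019867884480; 30578803779798945618266880];
  [:: 12047727275175966562417680; -7228018987372385221688064; -2926393543959330998748096;
   -6894744125970530412861696; -14105236587687858159879552; 11068187090348588511168;
   81617626214776931826710592];
  [:: -5826043753226202393968256; 5401408586251681969390656; -3847435281781038085507776;
   -4061618787612120787692288; -25704919060219795587529536; -32722969947045103907172288;
   10975397131483981438917312; 30349054160076481939340352];
  [:: 21465119101542728616810432; 2113186980956932071563328; 28198793484039209062363200;
   -16941364437498463576354752; -14088424267824578657428608; -40898045231236094875858368;
   19861109070910529781059712; -29260435853814400293296832; 53537583900798861939440640];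
  [:: 9309552730206948771304896; 5351089949208845305548480; 16500392658480009617984448;
   -12307894954819001532853056; -30083706542290680630755712; -36981549916223379428693952;
   -12087819081399190202479296; 22780907693658937609516224; 21400227565108798282994304;
   21501639008441302698358272];
  [:: -7755942772142807724410544; 15874621828336917372798720; -17945980706975392831364352;
   2600896803525329992924032; 7724991876956716264113024; -1917619588602149940877248;
   8379785461610626593317568; -13034003066923504472129664; 18171707981488284515320512;
   -3342242646073995726585600; 31864938309071526934883520];
  [:: 5937041625645402544276224; -18152645050149135167271168; 10409583215719127376078912;
   -12398269822992884985911856; -130066596421692673721616; 11707055272869914638055232;
   -16364857881370062467037888; -8077974485816818642568256; -16482070592596007971387200;
   -12866238735772294088536320; -19224411021506763017231616; 11921535332417729244625344];
  [:: 25678330696704627238644864; -33430293299808411018883200; 21416042994301681628614272;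
   -39052729781079234258918528; -45254382940064465457187392; -18429724182230047574369856;
   21754593523733412732926976; 42826599795969456046183296; -25209574428010718967496704;
   13056542308821633749829504; -38359760510531992767396480; 16428084898630149101035008;
   42336345867130883485310976];
  [:: -15361857473088938960953728; -11637428400227761707901248; -6088058705516042380017024;
   42587200934997512797236816; 20031054232625272216923840; 41365309099223652847596864;
   45300539924732804644690560; 11983432311225574340188608; -42311829532975299648251508;
   -40788440899334844090110208; -124881913164242314654852608; 27350085720393408932498880;
   53630333721399834989694720; 194005531803177098940703680];
  [:: 17556238953392869073678880; -17419575545424369699452928; 33003238716940215251373120;
   -13903555657254093883115712; -12936191419150352899514496; -23432965607668502700936000;
   -56864403813233084552244288; 4289868682872955634422080; 21709970779707172457073216;
   12654797653243136979555264; -54304268353686851104465344; 17883236897341098093917568;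
   29095778243716907804598528; 72729394466901848666084160; 57620469422229941334493575];
  [:: 54377922443734597516807680; -56894714305428432350687616; 22632558902455270788648468;
   -90522453752736484996509696; -28372457528964953529849336; -168038876134464463269504;
   61467251964476756292240192; -46386664881625373929113600; 57070329572136684326003712;
   -32082440428563416776025856; 105920222243465475253260864; 11494654948573159917096576;
   10833551287285958280327168; -241869866818099168377759036; -75296928997587029486523264;
   218417700363634473391709292];
  [:: 14601258383301666661493364; -20668561723020398092050816; 29277831402543533370308352;
   -11697699166284949738335360; -25680019932433849699113408; 99693755236788090833664;
   74927456606591313195260292; 11480141742082005888542592; -6560160116697922311840384;
   7312198952380342292642304; -74998350625019196760905348; 22376532718765503372466944;
   53104259833246737306297216; 174401269735067127894370512; 16211149564919516496620628;
   -98757680362285672573648704; 94454446967287246978904136];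
  [:: -18077549327582744470046400; 25421687478408483544631192; -20791758389315909198854464;
   30913740385097629735336320; 5014243103590191966359040; -1758480433783947396078336;
   30864322323108409701303936; -9253881965831729705474688; 19231627978349135106746520;
   -5703650829434282700229056; 6083819653407897639940416; -13548139474940959403623680;
   -17207419199460685426718784; 14009126236217491469150016; 9979839566944472869585920;
   -31496116228567490624415516; -9162364931508737490018048; 51154725687443962277959368];
  [:: -51531773909810325083720064; 29608560236940948321176448; -33977881833570890085290112;
   37507196046323265051195648; 25518301604570987258853312; 7400852350970487046273152;
   -38648666746900889882976012; -4302316588639095149846976; -27417819224225964604483416;
   -28369098546901665795456192; 42520498059047932737323136; 9105871313808169035403776;
   -50657660615811121140666816; -56805383978233737935212344; 4216258939419688742165376;
   19386500649696854105680512; -64814559962357164607739456; 19394639435524523557590720;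
   154904298336693280293221088];
  [:: -4556226572019322020361728; 7132544096998689071524800; -2977958044021583421279360;
   5979518368965989622859392; 817983094582706808691584; -2371919085956800122906240;
   2985184701337595078044800; 0; 1755766727860288134226752; -182095330294238726242944;
   -1681377070322077170698304; -690258023663010272300160; -2610509330839584817602432;
   8223238981145010192106176; -668653961759211052912320; -11557218545059559336788032;
   5561041960642767181723008; 5988102743504123655754176; 3874645226000570554368;
   1184443380841005188570304];
  [:: -4637283514143043441639104; 13013330312956948475466240; 324352133483946609552192;
   3457706062609910960392896; 1156378695247044722052864; -22623023561930621893527552;
   7375358458024967366573760; 2534801208476920276620672; 27163875070838849897955456;
   -1686078348309941534410176; 1427785445423825877286656; -2394735482616414561892224;
   -4641360790722992002681344; 9038379353751530427889728; 9522602449489260530612928;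
   4715818631622734958736128; 0; 8407254491904664618339392; -373589386917017408013888;
   4561584431032730920040640; 13176412541071134772900032];
  [:: 1581902317316630859013728; -971591818167491392422144; 1904491295298033610512960;
   8816766804159300991141632; 4292411149783511578847232; 16034577806474167958309952;
   60738527260640414795398272; -18369416813024681284573440; 13476788759424891630007872;
   -3143014017771759164491392; -962903286722968440588288; -5810733596894594693833728;
   -16339009406613428774834496; 20872218730232013255695232; -22666006862386605089121024;
   -7856487034470769565337984; 40305212273764320184659456; 18456336773217628510021632;
   -8766612895442161596008832; 1796374749705862071366720; -9123168862065461840081280;
   26124117086850317882721792];
  [:: 14261119433727403243241664; -15992043106499284276273536; 12248453674741401986882112;
   -11612029752967420011375360; 5408344673787397647121344; 2686418173973592769493376;
   -13176007001797273623817344; -5356406676164473430892864; 8472062713860093485877696;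
   -1254882547625454680283648; -5170193428319088774511104; 1309636491685332526793088;
   695151407001697700275584; -2679530676760439863884864; 26313602152874262754214016;
   6784312268428790300891136; -17459979687528886029525696; -6854546501035220564172288;
   -8148900999099174841929600; -4561584431032730920040640; -3644645719277821159788480;
   -5299713020445195871829376; 10168250599828826826558336];
  [:: -530137263688349418421416; -20429995750157115761259456; -18213471504685459380191616;
   16250519780222838487058880; 30878718413029773439234752; 52053990818163040370866752;
   68398044624614039326981452; -4878276405244362202972032; -44027382018680011544104512;
   -47182799500585186696638336; -42218205267875159717929152; 9508729557723945519282048;
   23714510316480566235265536; 148204791393541387315519104; -33608062739754378753818688;
   -31269988844751676969636272; 39939868694682303977242272; 16589979875205852277580352;
   -215397877041233898313793088; 3759834570994671723499968; 0; 33054843414639958985069568;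
   -2764297307639249176658688; 182255561007376834190957856];
  [:: -5152453126322808376363392; -24694547689968849255328128; 16924086531555792984971136;
   6547867640776772887612848; 36788247575480640763884096; 56240973893921181088458240;
   -133295875505165508862256640; -62814006206243814741259392; -34592508362477589356973888;
   -33683573822458064571297792; -56418684928291280327895360; 59576009072323198465771200;
   -18180065768890554542768832; 87385624786684227447677376; 66259891134629898819993792;
   -72589652431371395302314816; 21483039625569607391722944; -33154614115857878678660736;
   26213049490074950267145216; 0; -13947139491484021665670080; -18487738809566084100822912;
   8571756439443346552649664; 23725469613971520370937760; 130440050534481365816424000];
  [:: 26795426065245119742045696; -11712489571951104223222848; 14702226327809236758871296;
   -15485168738208827437034112; -19001145321732371279201280; -1373821667557541501973696;
   13150212039315718769616192; 6636665535393247066817280; 5122745127906568117895808;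
   2616387456049160560303680; -44638077415114766290555584; 5640088414931285041786752;
   51923342548778889528293184; 117844552157749620184257408; 45190155968135725236452928;
   -44142909321424996663737300; 73436143082017816619519616; 1821596518371679354084032;
   -70656069619750147035224088; 1604006572188495792987648; 8264861714500508372523840;
   -23347931656983750058581504; 5852678980546965255923520; -23367471291004987984349952;
   -5513229671347181643710400; 76334936904473002386884352];
  [:: 9544526607812621804881920; -9535513641983656431375744; 8840080094953652993099520;
   -11462083737988754905360128; -2012405754787293052053504; -1221483826160540613310464;
   -19908022093225139386554624; -5197185132939653752337472; 8185823811917482902000192;
   3473454248805616229677248; 1597862592284683528907136; 1696018910308441803494784;
   1198019376938914144173504; -13767238074305239886520576; 9627300392973098605976448;
   17670581207752678546467624; -9472164358189622512617216; -14365110024210975318173208;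
   -7382995673542430235909120; -3046993670657467712985408; -2515095919924526267531136;
   -10977221900965797568903680; 8099973613352551064238720; -18790912033695595897164864;
   11449125577367093978949312; 9894232147814847477950976; 4607771684680520400610368];
  [:: -11655102427307922979655424; -7992538678707037805712384; -16705756169328806715465792;
   6661824561920847549193920; 16202522231988736768869576; 31637891635514253933440256;
   -34036172868760345683952704; -31073297439504393661420800; -2008013044156658656815216;
   -29748356889429709823973120; 19530347635991079649751616; 7654167520102517957294400;
   -18154387743387898808691072; 26580478012220587246625808; -26420226172133283587959488;
   61146310833174704795887440; -16528239560244333635494848; -18980528835348523439606016;
   19111332496936733085662784; -3592749499411724142733440; -5342223943494395057909952;
   -19764646152707336412333888; -6094102619298766983723648; 13584198679264714263932808;
   51680081946397227158721600; 3822759475234869093040512; 14624225588135447003814336;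
   63553481841657839146647048];
  [:: -1597508310415069050324480; 35361137112570161155840896; -22211046371774117962089216;
   16779660488928598164209856; 4288195893568627791558720; 26110287565984677962383488;
   -37143805601356771526818040; -45334096984340032966788000; 13696341044182104656722284;
   30877274014116817821785856; 84728112599347847968485312; -40338880370612882469886464;
   -75866476888752879593658240; -208391896144615884528301056; -76915037586525076772235072;
   63543909338639069541059772; -100307823230283495271056048; 4627340258157398895279236;
   24983258993596392860954880; -3138499035312619344486912; -40673002399315307306233344;
   18571893724950691318795008; -8893950378296219589963456; -129572016709393968689790336;
   -42513298581663617752354240; -25716505429610815927231872; 9356864550358095666054720;
   11906187938438798241121248; 154483795255523039268367680];
  [:: 12238627127067607873305600; 1727301207953236428703872; 8097239148685417379341440;
   -22453319997650593886123520; -41374803489793010416466496; -48323036090368294970541480;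
   -8979178241394176256124992; 70871654375498178236371164; -6115920749604394217178624;
   53023089410317053612123264; 4253159542942434118838976; -30022001536396759298471328;
   42618730958461273749008832; -21555190758118960456601472; -18420610302148820507698176;
   -25364940835674257347165440; -3417476832989348592598848; -93263432159119198170528576;
   -60394126021360110103874112; -5517967518243632024286912; -4271156083405623629638080;
   -34035005678088790669067904; 29947316535992296888128; -46682610405208476438808176;
   -104866994991727777923037440; 29459475999439342563998016; 14818834020498001492154112;
   9286943338528662809750568; 29671088939642447929533240; 112776557304878442089503056];
  [:: -13595803783523936990630208; 2784263836956119341636032; 2199725973903807286800192;
   -33977154075245371983288384; -26265291102495665889837696; -76854680631332958208713408;
   -71312004388405840790501568; 42451620623402230488580992; 25367048466176419422260544;
   17602717112542774262996352; 66159997014398298250380108; 284641411846411892669760;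
   1489142407712582248015104; -209434090222808287412951232; -12243571833640499228650752;
   176321285422285108301209728; -152459836575763529226139584; -47831002843779929791063320;
   61866153705330553213616544; -3378936558179622734990784; 32817253356110767062854016;
   -61279449019737968784036096; -3504263678357766886406592; -7160837965073243154114912;
   -28538665232801576170652928; -155486099041823994419321280; 5958563091745938770929536;
   22961966103802695257111976; -59405223618261460589834088; 66248623521331599361616640;
   207186301301877804368401728];
  [:: 25087678063379573549766708; -26488876473455255948062656; 33854345242057886813701632;
   -31478951136673050646641984; 33691945134877731417912768; 20253756125998165971397824;
   -61482024899268525767445120; -33890038830361778978637504; -19764919782598163171682816;
   -14514932309661320755033728; 1627921041988328119429056; 33809085384151121852113152;
   -28552372337663423347108032; -111735757477289570548278912; 40312104009763300504960896;
   44881929523305064964340864; -37580317208531766847624488; -44399431326948615798845184;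
   89923753250738732585996544; -6659696594126475170510976; -8983545833695755860322048;
   -10107382912185626137939968; 35201483053369077357481536; -114630045555744103886946240;
   96639143049704908081959552; -23489795623176713727719568; 10116000303597456026951808;
   -82291767074963997439578528; 21825080386621125922541280; -81780356121722603299572264;
   -13281818930748657565905024; 148585779534830716045254864];
  [:: -28226708025503724814910976; 25410157306742969732309184; -7097911588115050902446016;
   77604862888756600190857608; 31901510639078852889572928; 41603077125580483389526848;
   15465644848344644538761088; 15418599490651627676564928; -46273462244388479741807232;
   21140804513842080378347520; -108816432825800170437639552; -13870881512371975045552068;
   -15113091134256596810233344; 293669914568915668510045440; 61085772472220845666720128;
   -417519288634717694647680396; 176368140665600096248580592; 27794077380555773508403776;
   31197061164005382000744576; 3592749499411724142733440; -36200572203057574153735872;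
   57832493253858069758667456; 7371738533525823156864384; -65742894818676242604664128;
   42164367995662586247296448; 103813134147266478291270144; -10157933243117138845132800;
   -49505676192267681170948472; -5238486794989616786224680; 14774310558862852530283008;
   -380690475508470333130752960; -4955208271886564536783368; 305887384277759706627376728];
  [:: -7287809964115233430437960; 11488599991920851938486656; -14255408383578959030421952;
   14185075369872600400610304; 12734386829935814510083584; 1017993812163541042655232;
   13080792668954577737309568; 40076914983672537274601088; -52294921305002794779444864;
   6190743423756028175210304; -15471184538426863075777728; -10785653342975271261245184;
   12893956566905716711383744; 7407469057645141227224064; -1517218327321209960752448;
   -93976494549122880653865984; 3500615625743423144362920; 28437934824537307918885236;
   -34741007115320589210007488; -304260172185052582272576; -6604098193526566838409216;
   -8050936546125746351033472; 7946376339505222302672384; 35150221392007554612804288;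
   -49762398272298294034672704; 19054564335308175509639232; -8664556576483127187806400;
   -68609363076259281936479136; -19090889938219951319466240; -3530193094945333249507824;
   -61427738047739538143392176; 46632990743741875066488576; 87029285781443312915037120;
   61280884265952333681345984];
  [:: -571964462190205889409792; 13254326838686712156757632; -7688793571862117395893696;
   -924967386660438356114880; -10967347522785619640581632; -12517715931889971712510656;
   53268149469014729094403008; 20434082205006652976198292; -3303762916742360129813184;
   23598310607946195592116096; 32898346085175793930300032; -23988017424670859239546656;
   -8176327937869927237503552; -95356495970234878898097216; -56144241150081109855632000;
   16660225332476736040755648; -8127025577097352015802184; 19312083653880884868737412;
   4669576126359748100437248; -871963484706605316801600; -11171460918738874319824896;
   24067167326921402015536512; -8597835870156429979965696; -38109176898295368305405568;
   -97611115338021036385288512; -28685317746055279885849152; -9605859938437942952929728;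
   -56141921865626443915263360; 70457761002530262513810240; 12279557104169946324262704;
   -15968553451238589426333504; 21147064117296633345133800; 15534669819911554407972936;
   51765135613981960376724672; 45102389746728605425160064];
  [:: 11283900168794344512911424; -1716012590108116138762176; 628850379475663317422208;
   822764061904415947138944; 1571093375720968849667316; -7722815624391408895024704;
   -35210881744300379559062016; -955665613652993273264256; 29201621783870925324815616;
   24722471028114457551150912; 15355262769470847115871616; -27847436814436011669008640;
   -15926108144850461625312960; -60031965256044062568439680; 19322059551728896848885120;
   -22512888347611460366508756; -81340599330908227987768128; 38303747225186371074660096;
   -57848969965487677337015424; -6946279819159613503494528; -13214530763890143069355776;
   -10566651803838720718125888; 26871139219892822555551488; 12437396239560529529559168;
   -32799591173948166877617792; -9962725202852162379217920; 11326847481746937403648704;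
   -10759587750657844724756088; 58933488137436924430928256; 9260600499994737713931168;
   8219224548259023274875504; -21056849809107869468169216; 7181376557799079732150008;
   35840783413322142746135040; 22826544667124796264509568; 65450518776544568814522144];
  [:: -9327371920023394160934912; 6364471747470817478895936; -8468660216159193247312896;
   1346852358969665169878784; 6124006311556386222883020; 12621713290372332293615424;
   25183565429585935247187840; -58919201409285218745216; -35359219274533650633589056;
   -17609486037157494851925312; 3550266285921323916178176; 15077708506345202406323712;
   2359176476747654618873280; -8321473502352925503994944; -38384372747023136313151110;
   30676042039438881798435360; 33045329648624463521005248; -16331564580893648581201344;
   10232767273437303921025920; 4810768114184512402386816; 4000381851479310841027968;
   8360224579161862901214336; -20526637771544696037043776; 26730286357161760779576480;
   11259771904286797975566912; -12169917200812844842098048; -11233059913714795010477568;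
   -9366286217903572919151168; -11734011617218481441434044; -23267044336592441259346032;
   2559939267563559987257568; 33610845950358346846116864; -44901355758590898758434812;
   7611667187906854752311808; 9726772942322395424974080; -72985350896523694720650240;
   32053278684494398001010912];
  [:: 1396435864108423379224896; -2551718880537841683668736; -6816514889646867929502528;
   -4480913093260014517144896; 8668817422203046346054784; 13746258282694788917713152;
   -24954751778414756647060800; -5505391011240519329443392; -20381187470839341974403840;
   1903119673306261832300736; 26311963743838369463853888; -4033880964987048868872960;
   -15254392012333097385402432; -90774795968413182755097408; -28960246978057564436020038;
   38698892782401797064635052; -54096398843430789759152448; -2878368032812460108057280;
   -15983486277624059678022528; -4312400747880949437694464; -16901685874596589496271654;
   -5776939393646448472036416; 4624606685090135401276608; 15933420091076181767130816;
   1375077437061634251760320; -38402692715521003238110008; 3354271495630133440228416;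
   -2981460695201282607318720; 60272628053143345498162944; -7161946953913770478540344;
   33767136126687167897182800; 34671703874868225295270272; -60885412973175317497903200;
   25203603121309224225123840; 27272201779849652780305536; 36492675448261847360325120;
   3008861559097747865290944; 22464029448262531143847008];
  [:: -343959711835180827133440; -643128756684323195417472; 10238727015594075484563264;
   3169094937639956176275072; -9381664493213812244254656; -13808029162249284868540800;
   21171156617773764494407296; 1082207966552128835857152; 27819316336116626876681280;
   -3391066836516927153896640; -28276237334466055883570688; 6236771896014424773389568;
   14192240757842634785432640; 102299203195186464274253400; 37900134986760518198361252;
   -35967235182285525279397632; 57347571867985385277331392; -2683808508880097490051072;
   35067823790820266949414912; 3703236467714370268140096; 17437731757885246224391347;
   5918325830720260318982016; -2564793604129851877172544; -36205513460826387590506176;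
   7839755085229893254689404; 41728543473573717319686744; -878537087897697551676672;
   13162983444712075038318144; -64085641979045927324287104; 10236385757001722580890496;
   -34912165517746970430840192; -35424956835204520506601536; 71994968616075892147224564;
   -42583130114793956907196032; -38104922913550761088510272; -42577429677907416010114176;
   -9140043713152850922181824; -53931934890552453260613120; 34065797580007021923884064]]%ZZ.

Definition sextic_cholesky : seq (seq Z) := [::
  [:: 13313];
  [:: -11732; 9422];
  [:: 11227; -400; 7536];
  [:: -14340; 2855; -1794; 6874];
  [:: -7370; -2100; -3130; 7369; 10666];
  [:: -2272; -8524; -8777; 8706; 4312; 8139];
  [:: 4678; 1859; -8878; 1484; -6868; -4262; 25912];
  [:: -2262; 147; 739; -7641; -8496; -7789; -255; 10777];
  [:: 8334; 11537; 7537; 1822; 2156; -6528; 3605; -14600; 4090];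
  [:: 3615; 7437; 6327; -3152; -6583; -1007; -3160; 2923; 3532; 5288];
  [:: -3011; 4959; -7560; -8359; 6196; 642; 1496; -6975; 4309; 5589; 5349];
  [:: 2305; -7088; 3330; -701; 1596; 4150; -885; 217; -4021; -3773; -1732; 1213];
  [:: 9970; -5926; -478; -6231; -12045; -2596; -461; 6946; -4395; -5532; -3605; 370; 372];
  [:: -5964; -13811; 3978; 26354; -14173; -6252; 6172; 7550; -2431; -23121; -13025; -3898; 878; 2665];
  [:: 6816; -1069; 12425; 7451; -3271; -6937; -10675; 89; -9276; -6838; 3896; 976; 1639; 1494; 3299];
  [:: 21113; -4923; -16192; -26206; 13222; 4197; 8952; -21551; -588; -198; 9228; -1367; -1694; -2190;
   -2266; 1115];
  [:: 5669; -4280; 11409; 7785; -11401; 7180; 15852; 8068; 29; -7555; -10723; -5398; 2287; 4826; 1974;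
   -838; 1554];
  [:: -7019; 5207; -3528; 5520; -6244; -4024; 3208; -9582; -12201; 6237; -1627; 1581; 3798; 2278; 5788;
   -1309; 1612; 1130];
  [:: -20008; -8670; 6042; -8356; 4381; 3167; 755; -6723; 1244; -4678; 22800; 12017; 6565; 9150; 10801;
   -2307; -1015; -1383; 2135];
  [:: -1769; 1710; 684; 274; -478; 488; 964; -248; -1087; -1091; -894; 128; -249; -362; -366; 88; -46; -5;
   -40; 174];
  [:: -1800; 4897; 3165; -2364; 2842; -5306; 2545; -2655; -2283; -5458; -2684; 150; -296; -402; -664; 111;
   -46; 1; -37; 39; 251];
  [:: 614; 232; 404; 7920; -2803; 4046; 11596; -2109; 1041; 5100; 2747; 820; -1435; -1864; -1239; 482;
   -459; -96; -146; 10; -148; 330];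
  [:: 5537; -1879; 53; 3613; 3597; -4429; -3457; 729; -299; 1086; 2971; 424; 553; 443; 1169; -96; -69; 14;
   32; -36; -12; -49; 203];
  [:: -206; -11464; -12794; 13212; -317; -6767; 8167; 3070; -12066; 2884; -18118; -11230; -11450; -16337;
   -15945; 4452; -75; 1718; -2789; 12; -225; 554; -42; 611];
  [:: -2001; -16039; 13738; 10997; 9723; 16262; -15749; -4430; -5717; -6830; -7019; 3243; -1481; -2015;
   -2088; 208; -570; -103; -9; 63; 12; 174; -108; 103; 360];
  [:: 10404; 6529; -5069; 6024; -6384; 342; -3441; 5030; -1585; -15742; -8483; -2703; 6224; 8769; 6699;
   -2027; 1487; -64; 631; 13; 304; -616; 44; -501; -75; 321];
  [:: 3706; -617; 510; -499; 1958; -341; -3930; -891; 2523; -346; 181; -1679; 686; 1317; 691; -168; 313;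
   7; 39; -32; -8; -86; 34; -31; -33; -2; 180];
  [:: -4525; -10020; -5248; -1639; 2345; 3187; -5812; -12506; 9682; -6093; -3577; -11841; 589; 3348; -754;
   377; 1657; 419; -275; -126; -204; -80; 34; 131; -143; -70; 147; 428];
  [:: -620; 18627; -13323; 110; 1331; 20729; -9443; -5329; 12218; 15166; 11575; 360; 1101; 1879; 1846;
   -388; -224; -545; 356; 8; -146; -127; -41; -405; -82; 136; -10; 38; 397];
  [:: 4752; 6865; -1161; -10125; -8762; -7953; -6590; 14987; 21106; -4460; 3107; -7746; -3308; -690;
   -5672; 1558; -1160; -998; -185; -73; -116; -119; 53; -72; -237; -19; 56; 139; 95; 280];
  [:: -5279; -5046; 9106; -32088; 7471; -15383; -8503; -9482; -278; 4610; 6981; -114; -9936; -13284;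
   -12416; 3811; -2141; 87; -1092; 10; -171; 589; -90; 678; 61; -273; 12; 66; -119; 89; 285];
  [:: 9741; -2403; 8582; -113; 25183; 9098; -2732; 11518; -9044; 3320; 10577; 15042; 3531; 3001; 6540;
   -2040; -1184; -1076; 1230; 101; 392; -227; 68; -285; 202; 116; -114; -390; -112; -83; -89; 311];
  [:: -10959; 294; 11475; 38364; -15192; 3055; 3252; 21813; 12665; -27; -839; 2822; 10227; 15107; 13670;
   -4237; 1067; -749; 1611; -111; -49; -370; 162; -416; -108; 25; 50; 30; 16; -17; -172; 11; 284];
  [:: -2830; 2779; -5415; 2196; 1657; -6299; 343; 17281; -8704; 9194; -4661; 1422; 3837; 2951; 5273;
   -1798; 1576; 747; -12; -29; 193; -304; 122; -112; -57; 61; -10; -120; -139; -76; -89; 90; 47; 234];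
  [:: -222; 6995; -4572; -5257; -1801; 962; 8580; 5724; 2666; 13843; 928; 6134; 2221; 1508; 3187; -1614;
   140; 26; 513; 2; 86; -105; 22; -133; 48; -15; -37; -124; -60; -54; -44; 13; 59; 38; 214];
  [:: 4381; 4514; -5856; 6355; -1431; -11308; -12748; -4297; 1814; 15231; -1626; 2238; 1186; -1052; 1871;
   -838; 400; 938; -160; -93; -74; -108; 98; -12; 0; -66; 45; 32; -70; -47; -41; -58; 112; 39; 86; 264];
  [:: -3621; -1018; -467; -6241; 4440; 9759; 8730; 5592; -5293; -3423; -1699; -1608; -1544; -1333; -2238;
   630; 170; -185; -266; 77; 90; 69; -66; 25; 23; 65; -47; -74; 28; -5; 13; 66; -83; 10; -47; -112; 192];
  [:: 542; -725; -5522; -3378; 5147; 3055; -4855; 1617; -922; 10913; -201; 298; -838; -2187; -949; 43;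
   303; 429; -309; -21; -35; 9; 21; 42; 20; -19; 8; -10; -18; -33; -21; 18; 22; 41; 26; 30; 1; 175];
  [:: -134; -519; 7194; 4197; -5530; -3153; 4525; -3550; 2988; -13415; 2307; -61; 1161; 3098; 1449; -67;
   -536; -658; 499; 14; 9; -2; -20; -50; -28; 9; 1; 35; 31; 48; 26; -27; -17; -58; -32; -28; -7; -27;
   179]]%ZZ.

Definition sextic_minors : seq (Z * mono * nat) := [::
  ((-147901910476528672806583296)%ZZ, [::(0,1);(0,3);(0,4)], 1);
   ((-75804376373824332068499456)%ZZ, [::(0,1);(0,2);(1,3)], 0);
   (11026459342694363287420800%ZZ, [::(0,1);(2,4);(2,4)], 0);
   ((-61091328664879808969320320)%ZZ, [::(0,1);(0,3);(0,3)], 1);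
   (68769921707878387389786624%ZZ, [::(0,4);(0,4);(1,4)], 0);
   ((-68769921707878387389786624)%ZZ, [::(0,1);(0,4)], 0);
   (137285985180288239257290240%ZZ, [::(0,1);(0,4);(2,4)], 0);
   (73950955238264336403291648%ZZ, [::(0,1);(0,4);(0,4)], 0);
   ((-43302411342178768533422592)%ZZ, [::], 0);
   ((-62724340995377879515788288)%ZZ, [::(0,1);(0,1);(0,3)], 1);
   ((-188936781044186604224746368)%ZZ, [::(0,1);(0,2);(1,3)], 1);
   (225674739713165121311581440%ZZ, [::(0,1);(3,4)], 1);
   (52430195339781445694711808%ZZ, [::(0,1);(0,1)], 1);
   (131550069871438086553850880%ZZ, [::(0,1);(2,4)], 0);
   (189015057726188567620500864%ZZ, [::(0,1)], 0);
   ((-48998068076085340563301632)%ZZ, [::(0,1);(0,3);(3,4)], 1);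
   (16174666334793007913726400%ZZ, [::(0,1);(0,2);(0,4)], 0);
   ((-75915371430537974581213440)%ZZ, [::(0,1);(0,3);(1,3)], 1);
   ((-16117027160521266438281088)%ZZ, [::(0,1);(0,3);(2,3)], 1);
   ((-198941861320905222873852928)%ZZ, [::(0,3);(1,3);(2,4)], 1);
   ((-507787358965658162892897792)%ZZ, [::(0,4);(1,4)], 0);
   ((-136984826395450074239523072)%ZZ, [::(0,3);(0,4)], 1);
   ((-230826200300006287624851456)%ZZ, [::(0,1);(2,3)], 1);
   ((-21902930120202977562004992)%ZZ, [::(0,1);(0,3);(2,4)], 1);
   ((-138891607906612669216111872)%ZZ, [::(0,1);(0,3);(1,4)], 1);
   (129078656466340997833224192%ZZ, [::(0,4)], 0);
   (18370779343150530334536096%ZZ, [::(0,1);(0,2);(3,4)], 0);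
   (13978946401623493396601952%ZZ, [::(0,1);(0,2)], 1);
   ((-34384960853939193694893312)%ZZ, [::(0,1);(0,2);(3,4)], 1);
   (47890112784144072153257920%ZZ, [::(0,3);(1,4);(3,4)], 1);
   (931097497139266440136521984%ZZ, [::(0,3);(1,4)], 1);
   (160345108610392018529555328%ZZ, [::(0,3)], 1);
   (283982851779192540876035904%ZZ, [::(0,1);(0,3)], 1);
   (294080385800080070373747840%ZZ, [::(0,1);(0,2)], 0);
   ((-391232179775290942450298368)%ZZ, [::(0,3);(1,3)], 1);
   (77798840698619930245327488%ZZ, [::(0,4);(0,4)], 0);
   ((-102721414973585207396528448)%ZZ, [::(0,1);(0,2);(1,2)], 0);
   (83979388691392361755747072%ZZ, [::(0,1);(0,2);(0,3)], 0)].

(** [E = 2 * 32 * (3/64 + 6) = 387], and the uniqueness terms have weight [kappa K / 2000]. *)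
Lemma sextic_certificate : energy_certificate 32 [:: 0; 0; 0; 0; 0; 0; 1]%ZZ [::]%ZZ [::]%ZZ
  208710128266200000000000 387 3339362052259200000000 3339362052259200000000 96730084182889984
  sextic_vectors sextic_gram sextic_cholesky sextic_minors.
Proof. by vm_compute. Qed.

(** * The potential [Gsharp10] *)

Definition sharp_vectors : seq vpoly := [::
  [:: (1%ZZ, [::(0,2)], 1); ((-1)%ZZ, [::(0,2)], 0)];
  [:: (3%ZZ, [::(2,3)], 2); ((-1)%ZZ, [::], 0); (3%ZZ, [::(0,2)], 2)];
  [:: (2%ZZ, [::(0,1);(0,1)], 0); (1%ZZ, [::(0,1)], 0)];
  [:: (1%ZZ, [::(0,1);(2,3)], 2)];
  [:: (2%ZZ, [::(0,2);(0,2)], 0); ((-1)%ZZ, [::(0,1)], 0); ((-2)%ZZ, [::(0,2)], 2)];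
  [:: (2%ZZ, [::(0,2);(0,3)], 0); ((-1)%ZZ, [::(2,3)], 2)];
  [:: (4%ZZ, [::(0,2);(0,3)], 2); (1%ZZ, [::(2,3)], 2)];
  [:: (1%ZZ, [::(0,2);(0,3)], 4); (1%ZZ, [::(0,2);(0,3)], 1)];
  [:: (1%ZZ, [::(0,2);(1,2)], 3)];
  [:: (2%ZZ, [::(0,2);(2,3)], 0); ((-1)%ZZ, [::(2,3)], 2)];
  [:: (4%ZZ, [::(0,2);(2,3)], 2); (1%ZZ, [::(2,3)], 2)];
  [:: (2%ZZ, [::(0,2);(3,4)], 2); (1%ZZ, [::(2,3)], 4)];
  [:: (2%ZZ, [::(2,3);(2,3)], 2); (1%ZZ, [::(2,3)], 2)];
  [:: (1%ZZ, [::(2,3);(2,4)], 0)];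
  [:: (1%ZZ, [::(2,3);(2,4)], 3)];
  [:: (4%ZZ, [::(0,1);(0,1);(0,1)], 0); ((-1)%ZZ, [::(0,1)], 0)];
  [:: (1%ZZ, [::(0,1);(0,1);(2,3)], 2)];
  [:: (1%ZZ, [::(0,1);(0,2);(2,3)], 3)];
  [:: (1%ZZ, [::(0,1);(2,3);(2,3)], 2)];
  [:: (1%ZZ, [::(0,1);(2,3);(2,4)], 0)];
  [:: (1%ZZ, [::(0,1);(2,3);(2,4)], 2)];
  [:: (1%ZZ, [::(0,1);(2,3);(2,4)], 3)];
  [:: (4%ZZ, [::(0,2);(0,2);(0,2)], 2); (1%ZZ, [::], 0); ((-2)%ZZ, [::(0,1)], 0); ((-7)%ZZ, [::(0,2)], 2)];
  [:: (4%ZZ, [::(0,2);(0,2);(0,3)], 0); (1%ZZ, [::(2,3)], 2)];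
  [:: (2%ZZ, [::(0,2);(0,2);(0,3)], 1); (1%ZZ, [::(0,2);(0,3)], 1)];
  [:: (2%ZZ, [::(0,2);(0,2);(0,3)], 4); ((-1)%ZZ, [::(0,2);(0,3)], 1)];
  [:: (4%ZZ, [::(0,2);(0,2);(2,3)], 0); (1%ZZ, [::(2,3)], 2)];
  [:: (1%ZZ, [::(0,2);(0,3);(0,4)], 0)];
  [:: (1%ZZ, [::(0,2);(0,3);(1,2)], 3)];
  [:: (1%ZZ, [::(0,2);(0,3);(1,4)], 4); ((-1)%ZZ, [::(0,2);(0,3)], 1)];
  [:: (4%ZZ, [::(0,2);(0,3);(2,3)], 0); (1%ZZ, [::(2,3)], 2)];
  [:: (2%ZZ, [::(0,2);(0,3);(2,3)], 1); (1%ZZ, [::(0,2);(0,3)], 1)];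
  [:: (1%ZZ, [::(0,2);(0,3);(2,4)], 3)];
  [:: (1%ZZ, [::(0,2);(1,3);(2,3)], 4)];
  [:: (1%ZZ, [::(2,3);(2,3);(2,4)], 2)];
  [:: (1%ZZ, [::(2,3);(2,3);(2,4)], 3)];
  [:: (1%ZZ, [::(2,3);(2,3);(2,4)], 4)];
  [:: (1%ZZ, [::(2,3);(2,4);(3,4)], 2)]].

Definition sharp_gram : seq (seq Z) := [::
  [:: 400802328774069288335897562];
  [:: -584641451184556842357166080; 321547736369979881204708547];
  [:: 1609750915407964650925393920; -1144802547753804848264928554; 2049946434269615920070989896];
  [:: 327652132347529957024911360; -295225382502790240448563200; 282972006685503985368729600;
   1745770898104401523350528000];
  [:: -652192928027695583418225150; 469618668846061666749319200; -1102735060856435459982597120;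
   -801167961294809171634069720; 373759218226278878743526400];
  [:: -924217097326773074279470080; 555983529599089010704296960; -1270682184147586364937968640;
   -208988489929109450651919360; 952914393739688367395865600; 1066930184090219072689428480];
  [:: 32257375135157740109967360; -318697202749148332459843641; 106372805856910006967654400;
   -234167316236279918650828800; 221709959512357658537594880; 468833008473210845564006400;
   518747953071379376090004480];
  [:: 165261979343514468847011840; 54075821383104193736893440; 562703176121703614180951040;
   40775572948624818472685994; -44973392149513004390553600; -55008747431589907489996800;
   -243252767616483438678159360; 619735171232494342499834880];
  [:: -541333392731306572979312640; 328797576356927252979456000; -1204161900212529681263493120;
   -967504438359898507013437440; 244642845820818618135705600; 561979241784006383027957760;
   -203953884002925634132439040; -595594038561387046422797484; 1504049033123049683527695360];
  [:: -40333087883533364859064320; 242176532955121550679828480; -41156338936685897549214720;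
   -470455067190146477944826880; -68005142937814067938667520; -520530632648919579566131200;
   -1083954845249804728644387840; 431946398979690574584683520; 357410677787799511383106560;
   855588200251429073406781440];
  [:: 251385495094207683963786240; -40195435391890457522688000; 376681128414226286121023299;
   653903537362164888738600960; -474440705916136983401564160; -492162906143166126487557120;
   -592324085577778682273715396; -75041717444850856305116160; 35286695494092025693332480;
   443969192003368383072414720; 368723889904928355645419520];
  [:: -263448155676873118516531200; 118463720487795866045491200; -453722071172856148359735186;
   1037857269301395165372072960; -11284215566288219030949522; 433492679448989106896701440;
   -146971549073112772075591680; -407549418090376718982758400; 122776439919438646569047040;
   -237852590210224554282531840; 147554830479743748906647238; 479976256715722623983141262];
  [:: 453259335409047980736168960; -393715279393711870994380800; 427631893590715619143713899;
   91408952224283719766307840; -371287909713569679389445120; -731446367302702353880581120;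
   345456281601567102754944000; -110656883027671321624223664; -293845919843331720656962560;
   -419635106817518412398223360; 61498440811637351514869760; -373447566460716746115686400;
   382107642746962134813557760];
  [:: 520165887203704190535290880; -469036744588369123040010240; -72976392616043397534870536;
   -1922417090395653342378638787; -292400248880064480063667200; -1856669565747502944342927360;
   223919059297971987274890240; -267000795966590318492421120; -189263709424441182674856960;
   410714715915855335047265280; -152850806872885152016128000; -1506625196082001229617044480;
   1119966986424221409170211840; 2412941556006452242809722880];
  [:: 169839191686963357242178560; -503624893145729864889369600; -199929600357323936426496000;
   1108123676285579325710205114; -650999121217081813883141034; -209385734692259370217190400;
   -238561503393485261655843840; -844122673467150274632913920; 1141530430151170189499166720;
   -229651637785433923511235048; 386673289178190110083353600; 1443860340936405190235818482;
   102141524385720849243202560; -712538636530544033997496320; 3589141475607499119491389440];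
  [:: 422527000522539796094914560; -304263527788968827084328960; 1163887995534802895473431744;
   37254050535502322640766860; -249056426161998307857438720; -270660784085087032772029440;
   96265433491067067323013818; 107588340883961977351403520; -403387221466325724092974080;
   -109789811348611328923622400; 46479524310443631720141439; -65869508621556617538847104;
   88655275512742718602153161; -169927488325918112255546496; -68450658358537242448915380;
   178328027502636171264000000];
  [:: 2752597128616387728399360; -23867586053208197470050908; 121466220653002992311301120;
   468262513711190185323664944; -105505135657708929854460576; -168790804631084675172424020;
   -431121428096346820041431040; -180238647739815530686332336; 246755518500933631738598400;
   844313689728436192154173440; 449006375108376379638789120; 20321834310697557738746880;
   -165408915847221538937303040; -431258373733039389569779728; -1094236831321267845991403520; 0;
   797333033283612979914408960];
  [:: -860648588125532096006338560; 663446086826767206552944640; -1291133638737778315557652800;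
   -1775237991130881375574565808; 1428968572295753708304583680; 1697897544404275026822297600;
   688026187920021078833602560; 603584767436836741389849600; -2039427849003280864113051696;
   -324073782696407936407836960; -843835670140706207820011520; -513733055290152915265551360;
   -175778616681607556106547200; 292928634407575067345782836; -1218594172489399632376120320;
   -214337813253616637755058304; -868119405085644343079685120; 3353572486020420195174789120];
  [:: -9900768420919822516162560; 117715986060519090157056000; -105237826315240490483189760;
   603011393605541474457246720; -1352925065853616948992000; 66395956211883941743740600;
   139679090928291940603868160; -133727061274042008865397760; -634822495651622012520913920;
   -656274873558181661227192320; -218512327607402294802585600; 422353843989284934983393280;
   -72920931051730438156910976; -378242723065254706169671680; 439802358406634597339586816;
   34284955981608899309513472; -863755755663454940354365440; -2798416069198985322547200;
   600526783149853466312340480];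
  [:: 89655669195537228172646400; -302525115708862491699870720; 159699394990718526874245120;
   786792372760407955731978240; -347247851636388508203340800; 12981053163196963926881280;
   151205790280271484859628061; -328817860633713346220793216; 1247641839168651702719009046;
   -312775109684743196774799360; 120249270986609996559963648; 412253360503417030426583040;
   123655430682561693158830080; -984172998846752865660856320; 679857428218277573357783040;
   12153488508621739692818496; 490969571285323880274769920; -2246674494568127917590324432;
   -344937424617272478241605888; 1064453407390172312671841280];
  [:: -39748677385282915015944816; 76240087717062344235264000; -155881709322413054442808320;
   31417888361016999147770880; -83458004524532959164676896; -348794151696473994542453760;
   -263950629604457263844014080; -162654749980207389595791360; 8028756830808695421322008;
   154866111866397211511162880; 243386190456856857063613440; 290595500297495717614617600;
   -16296137704757172779412480; -148860081846270896521605120; 715200385410090060701276160;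
   426698793475994207734176; 152364017995400547654444216; -123046091051401101172193280;
   -156414365121718067832898560; -326796989320127628728524800; 458201586056362835546096640];
  [:: -117363904860044488530493440; 351866845775557277324003346; -102069144167586272446648320;
   -2087335523612176470578350080; 353528457866919322070952960; -138883556101157711979033600;
   -196139196703238459779031040; 366810143906117038681082880; 691998140996729894391367680;
   449933827543707626380385280; -337040787099621306674718048; -694347764422973350884912024;
   -122819602421068720305315840; 1280335831544480706128240640; -169444676567360457100431360;
   -38996940460655757181173312; -852159903448027245697566720; 688396423490154934625940480;
   21751199606801154311976960; -904605667738830282926638080; 63986026362767551292934528;
   980259073911654014053555200];
  [:: -7226012884137920591815656; 84061769156654370213957291; -36192576432553559057225472;
   -104938834723225892993111040; 6016345997540700566279808; -67212049019153785184758158;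
   -99567951829649263044864000; 75910420621145041367454720; 63512330274686926012723200;
   84818533974120984244352796; 30714046460478639509620743; -71081914219882297618727112;
   9104656890223456281907200; 59542430951456207640168192; -102557457437951561674936320;
   -17146089878971864736128320; -36736093680885190911968064; 0; 4289935169899895546354688;
   -52370950354246617215346432; 10550176312538835981942336; 167072354304174428588743680;
   19351114492190504637912480];
  [:: -239007487365602087591946240; 331082026512086124672732032; -196007732879215725538475746;
   -128750633486972790817262736; 211555733745708633340800000; 475435128437041686195409920;
   -304251472535428029572213760; 278484535607319922652928000; 62477021565401613020697600;
   299468305071474257831823360; 81829473011484330463222584; 53630790771483412320532608;
   -373991642285590294185422592; -645049587664389263917916160; -335174153777891448308121600;
   -57744807375637844588662848; 0; 540919607864926451806554624; 10306839577942343345554944;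
   -135479271140640577018552320; -154083736853354289708657216; 188214548985353044382791680;
   46678979136213354657355200; 193785574653482525061903360];
  [:: -127230496774194502137646080; -172654863720479329505574520; 60767950185607058375479772;
   -11858758963747491493429302; 99205409635066825317526716; 532033767011304435076392960;
   404956640529523208052126720; 29459364826999182346552320; 276763246014134917368714240;
   -303659913782218391419806720; -92835945596335889725839360; -98912411627472413610531840;
   -100115077557736794370222080; -283990127446595171025515520; -831867342433676603481323520;
   482057087464714331980800; 343210618982187065098828800; -78160661352254427886817280;
   -577765185514295201207366400; 625888958262858439768120320; -175357036368114503461079040;
   -451499299932855813999759360; -100974121413349406625029952; 0; 575526699592731507656176128];
  [:: -43916256136670470672803840; 256104062031539749139573760; 95815311479649075464358732;
   -56798821022601017907723216; 15198008645694591900518400; -5862540268439574972595200;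
   -382156974706289762142858240; 880331104771257827860024320; 178967309816812152303682560;
   420241261614972763472133120; -35251026001675878414458880; -125063627638638830435123616;
   -280045492508624175094993920; -516804096739620706609582080; -430757989335719272160121648;
   -2620102148050907589013152; -190691060911392606635566080; -268468101397111974810895872;
   5120385521711930492810112; -91988347239830037432923136; 102489424127853470874331776;
   564009463014522385186160640; 100974121413349406625029952; 251664714719006215221324288;
   -71573907695773224514616064; 482301698118826287327125760];
  [:: -137175986374315669689891840; 82532632630276804386677760; 53585884575679632820147590;
   80181412386837876318597120; 247396945476025242980858880; 458988094224299161821911040;
   22270644834323399212907520; 158262164888802843619445760; -269371537837954015279196160;
   193218121904146118365547520; -167863447745039745304519680; 76882987219321972205936640;
   -370101747463496864263618560; -620648088512083554777154560; -714728393447299902617656320;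
   50907986438441951984033856; 331248922325700668027271936; 369140914329842276386053120;
   14581066017522151572781824; -319907243796291226492784640; -55552035431463143357285280;
   -163699304683747645909938816; -46678979136213354657355200; 112979271826859932127462400;
   52370950354246617215346432; 93241051338139474348979712; 250240435188169162756488768];
  [:: 9173990497520538631618560; 37065084802784792577607680; -38555599463006429704273152;
   -850056062189612679851379248; 34599894898130088606443520; -131654351527225291921046892;
   80505881795871556570142480; -465541460546929462598123520; 392627633089796399685611520;
   -66179850352576206353003520; 59192173516890969279388016; -203146390971882560406297600;
   40959310045149518431490404; 951195073602103854624626696; -690119430903311974911234684; 0;
   -159151337976192555729844992; -296040901587455121696368640; 172699263665234437698832512;
   -285056517740471952096900096; 21808685210654223594685440; 495838271004808560936606720; 0;
   -53729857249115512793451148; 10480408592203630356052608; -166717611822383510983031808;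
   -40723189423263711872501760; 590822330779776094968204288];
  [:: -192122950504956498235010112; 138237605748454666787573760; -518206414447272337030862496;
   206226603886398925803356016; 283832363652028583278049280; 591396782613008089553372160;
   652444524033216772560768000; -644318614599673365061032960; 1450807052786843650161269760;
   -964413848355670552312691712; -646745166222372781782266880; 302115464878817219556465918;
   188205842771533377536578560; -1063629445068072761926394880; 331303156353830137409786880;
   -70891054663221050414307840; -209647554129092887218837504; -1532567303297599195094906880;
   657562599562443733224069120; 1498385999069541036330071040; -734738618516806430556157440;
   -148212170693427283825319928; 60872865697462976973204480; -160576674841901827448798976;
   -517504705162154878382622720; -186063118794434314293120000; -84973313221992893905668864;
   -232167770663434712333660160; 2061774664346757911224227840];
  [:: -37859462466459964665753600; 246942616213086227660528640; -276742336475425626871004160;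
   438899235950108876522711040; 1160786802745328833152000; 25874578457601551144064000;
   -228621890264270994926622720; -166987012636869358910146560; -1012743204600006231915782832;
   12381411403593726653952000; 557315038800861746595840000; -89865231763039265765606400;
   193639852280650883151283200; 128417078034991539743938560; -1004125746942308495744725404;
   -75382724746972042087693824; 370268666348368610505061224; 1374760913366371597677711360;
   -54814658883856533161210880; -931975518282746767984327680; 231793286492274187993541160;
   -447301424132660117654000640; 28185450858405726051179520; 149508940082322807108360576;
   -177901994007885362837806080; -421860453188020833945883392; 33245192807677887477442560;
   154767055025116701308943360; -1048901611831187059827348480; 855903036751846531649510400];
  [:: 51265629607091728177290240; -130059288742574202240378509; 58346998251586790264949084;
   324998749092805510971755520; -104284892255715292537728000; -38253379420868672534123520;
   84825934679919696458830983; -67606699025194105332741120; -15210104918704093004405760;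
   -104761952649080401816627200; 3632472307217459064453120; 81260476878980010604861440;
   10537145728804664097223680; 3726983733234332251299840; 85234623412728480390552996;
   3321612150054576045861024; 50899271859514091274992640; -415806658653297827536957440;
   37327479003485922026880000; 175045725832250833959260160; -53525293770328442523601920;
   -249994817633657098945612800; -43822803479429416257110880; -86251566845610953418378240;
   175079189136989058988584960; -59251692902145913012506624; 20316998553210347588121600;
   25174164868466826423672600; -55919581819881734010101760; -117947836221342770744771904;
   53190784476969855101568000];
  [:: 472641368183713763858903040; -516890313435227992750863360; 781955221446002945501521920;
   783950143065922119835791360; -632462307027091467695907840; -742838016771734390100172800;
   -147228312451092660840499200; 1171128563536918586895360; -37301925609083007382805310;
   132397813059965720336010240; 279007398246446379224432640; 161236300380631892046259200;
   137821756338742876370979840; 243855169451071027064616960; 930206283693063237045566406;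
   153015142052970894366259200; 124344500845277001242254116; -1633823255243199217137408000;
   -43872814765624906702218240; 481238740107960701503430124; 49582586831592850660085760;
   -433516074221674300893993216; -74931479681997135721627584; -254431531692090585621135360;
   164488558125138468586260480; -19305901944119540720655360; -115691774954669761521024000;
   -87428418382889040340915200; -458411357360386532062771200; -420047434326547376318361600;
   213041234441013246026403840; 427739298051019314404873088];
  [:: -59488215799612753018045440; -164617684472717931627095040; -247959695590768185626234880;
   -792386638286046248165760000; 268432041754911655993881600; 105971307139810015227417600;
   469019351810095063551175680; 509236582525441070443453440; 395974093402465573822894080;
   -158546366736373629568788480; -770764667614007080826593104; -319738969352313690129699840;
   104992900422234998093107200; 448138306906428327755904000; 886268306657410196631815724;
   -67710066266072577201953280; -649792588816261364449397760; 318657053238256203898752000;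
   -170058380978991750182645760; -290090405034772119687226896; 130802946596957848291153920;
   805502104255905323249249280; 0; -283886680937600556409052160; -149826026923208891698360320;
   405190514959760157354455040; 84973313221992893905668864; -677675164621932957132656640;
   459951243548394673387653120; -982054864924492377320340480; -64551735084314515076193024;
   67027323965814541683394560; 1214155600205832361863152640];
  [:: 352750442471709664542750720; -252964900267248096099394560; 742329431488824016242263040;
   -117587284749908537753779200; -154148072356587966490828800; -884218839518801873360102400;
   -266029783696544385848878080; 145756814006245711974082560; -1761032660011341420118133568;
   772024144576595788546606080; 195008884034097939594347520; -551735383606186683468243642;
   126565998592239012285573120; 1306389209926769181937751040; -2150116160609023217730063360;
   180654378183117486066417024; 895767039314192316144107520; 1007882108343056537861437440;
   -357335606961246022775976960; -727076109638246970503116800; -185018389406202721769487360;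
   -498386825228959326831974400; -53757724490269756922833920; -38807785376083234203863040;
   88494179094157570298772480; -487610647149975257605432320; 284322786770701974485099520;
   2678443024959699049278720; -1568378290126757622024545280; 865831637704965642577271808;
   18445339653260434168550400; 155779942147684694665113600; -713764128601608689982274560;
   1305882946673826024362526720];
  [:: 255580802659756462211481600; -177144903246285876288291840; 143021988880227791309412860;
   283694454206584221739161600; -182775129017832512042019840; -167836175853885705021373440;
   176042558602072938839731200; 619351782065316379883381760; -574641100175831017229721600;
   -309859332877340288224865280; -54749184043981700874358896; -144198084886052656842639360;
   501258632878313026187627520; 30921284123899194213826560; 786507670247595766276884480;
   20463686773950615412532640; -622732382657725478777533440; 894362960997508159309501440;
   73103177293350034490449920; -107788380529289178696337152; -33178069766788160570403840;
   -5908304148466809603451392; 38117721915899350214877504; -51817942686373261321158144;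
   -399357033931320081889349376; 221895479317259937838731264; -232888493242672093764647424;
   -578595897555372107624678400; 96540621416523968173701120; 136203144088258263203066880;
   -134181321323034590643916800; -20315504533152133260783360; 879809377874230968282593280;
   -283088802127117947701734656; 767152070239410548485678080];
  [:: -56245295475953760152770560; -46326466934230702442895360; 19443590260066380995758080;
   -422913827995476548336087040; -34371196239578668918456320; -46280209135856777569013760;
   -318279116218939508618818560; -579417818298534577087165440; 519036203991564271906283520;
   484728613102509266084106240; 208567663090243103227576320; 256635140495371806230302572;
   -302836376621566681686973440; 388937456890817775976400448; 1617539199437796232154019840;
   -7156329630416780882964480; 28471069686252421365995520; -219936826003130588130614784;
   -73103177293350034490449920; -198985645330079293997805312; 158207242448910852156810240;
   313938130296151164456866304; -41862509825243459024290176; 31235292879702253459752960;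
   -87848485028927587302174720; -370421951597904155202339840; -63880618844222869795741440;
   283258705398241544441533440; -568867771434262331833251840; -176188832471483317411061760;
   42412144622113498537543680; 218779967987268661004129280; -350360910341054327652986880;
   -24638079403811155213721088; -746863666179413674517683200; 635177641102330771741870080];
  [:: 182081699746754287738752000; -248004752658057422694051840; 118302920462992158298663388;
   27963867045738898413434880; -177736872380900945921003520; -79865903491511127148154880;
   63756071329638223482485760; 34583588758678738163374080; 60959093907371322807106560;
   -48231252881055302745922560; 76634740378561018791121920; 56888794611526729820267520;
   294482355011952316572579840; 243455437134942202828125192; 2043854319290586757222394880;
   5765004490702612407258240; -439693532354670528776924160; 526000610553654223055877120;
   -120230771325579240085693440; -111433896410913851743687680; 111079648416681646561566720;
   120286227014903233230336000; -10182259230882535101726720; -100407621617106815426688000;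
   -308203630943339443738383360; -146821237026319057041380736; -259889471330997282782791680;
   -400250225819160772143795224; -132213172807195443745966080; -41550551905652182310261760;
   -66877090319116872292193280; 132034551919821848520437760; 644696616285794390182225920;
   -469062728243411566864204800; 784937990185031590925921280; 277474269997601429588858880;
   489484947002234298221583360];
  [:: -128241054389516785015403520; 195540852314303621487498240; -80349594203846633596369920;
   75160538020694188027330560; 184192050151605369319879680; 91987347077987190053253120;
   164705376108187796766243840; 114103751105211854336943288; -218787669835516306694108160;
   -225405129001111924382668800; -190437097243952958406225920; -202758634908092080318325760;
   -92278554396257145854864040; -254773053956312688143692800; -2524550309676957509958067200;
   8232446357738740957507584; 413079541296336015430717440; -389877520875488769010867200;
   82166252384963074698639360; 247745049677220642353838720; -202537284504403140942474240;
   -254901944603037486017203200; 17210019797198731368320832; 33595515574848270939617280;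
   396532497210875541035320320; 185371025674381530893178048; 231437444486430812551234560;
   251952503560628498615270400; 421730599981056259070361600; 81019793700346350892190274;
   56582941222135582757657856; -211927972455763159476726144; -450268574028006898459376640;
   457805452589491672567841472; -488594291102538249543183360; -713806346136083401529902080;
   -999495313924314173182894080; 601812367808976906430417920]]%ZZ.

Definition sharp_cholesky : seq (seq Z) := [::
  [:: 105651];
  [:: -77090; 54873];
  [:: 212259; 7560; 109541];
  [:: 43204; -14255; -46745; 210667];
  [:: -85997; -1590; 26506; -29569; 37864];
  [:: -121866; -30055; 76615; 26139; 39331; 76597];
  [:: 4253; -74933; 10457; -19107; 65842; 24884; 58192];
  [:: 21791; 44342; 26277; 7058; 21925; 2114; -30844; 112446];
  [:: -71379; -16805; -13668; -53510; -105033; 67915; 9438; -24984; 130825];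
  [:: -5318; 54011; 1344; -26067; -56128; -45567; -115365; 14724; 21301; 31627];
  [:: 33147; 36363; -18835; 34725; -57442; 13979; -23596; -23373; -17386; 23173; 29145];
  [:: -34738; -18727; 10902; 76907; -31407; -4797; 4121; -36405; -5664; -42561; -6181; 39288];
  [:: 59766; -15991; -60321; -20679; 24543; 10572; 29501; -484; -3500; 7019; 26159; -1397; 20369];
  [:: 68588; -22719; -140616; -173930; 9852; -42526; -5466; 3745; -40385; 55599; -36272; -49490; -10811;
   37756];
  [:: 22395; -96396; -62168; 48368; -111409; 62608; -56540; -54377; 6429; -183031; -7804; 83937; 55763;
   121389; 54944];
  [:: 55714; 1026; 39990; -19; 6938; -3738; 6850; -6620; -2503; -5778; 2244; 7305; -943; -1525; 356; 2246];
  [:: 363; -5549; 15127; 33872; -22364; -47504; -56360; -36079; 45077; 81435; 56835; -13160; -1198;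
   -37693; -6275; 705; 6258];
  [:: -113483; 9002; 55076; -81289; 166342; 19019; -48334; 39403; -170737; -3596; 59133; 23302; 58605;
   44216; 15465; -664; 1288; 8717];
  [:: -1305; 28051; -12790; 39204; 37284; 1275; 42095; -22595; -28089; -53351; -78439; 19207; -13578;
   7148; -9556; 268; -7168; -1112; 5202];
  [:: 11822; -60195; 1557; 45877; -68701; 15614; 43660; 2544; 84574; 6450; 5302; 2481; 70982; -52474;
   -33879; -8134; -3884; 16654; -4405; 18964];
  [:: -5241; 11992; -10496; 1635; -33481; -39937; 10021; -11487; -9957; -19705; 60398; 47218; -38740;
   23788; 26490; 6600; 8431; -9208; 483; -12816; 5640];
  [:: -15475; 67589; 12342; -127545; -10483; 13203; 3328; 29621; 13193; -35605; -32254; -2837; -21044;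
   40561; 15953; 2522; -895; -4847; 1539; -5603; 669; 2954];
  [:: -953; 20003; -4137; -6308; -1141; 985; 1532; 3688; 4967; -2061; 1730; -1795; 4021; 1339; 644; -45;
   -331; 265; 149; 72; -91; 357; 2041];
  [:: -31515; 39779; 33394; 8051; -9161; 20491; -21065; 12236; -12787; 3236; -8011; -5786; 12766; -4219;
   -6804; -1909; -2533; 3736; -399; 3565; -930; 246; 46; 2209];
  [:: -16776; -67401; 44887; 8056; -29565; 11159; 34638; 37541; -5215; 59254; 22512; -34397; -3080; -6183;
   -7972; -2546; 4734; 6854; -6507; 5881; 2280; 212; -368; 606; 4514];
  [:: -5791; 56883; 19480; 5603; -14432; -1946; -2315; 85067; 33367; -8155; -10097; 22955; -19649; 7688;
   193; 2300; 329; -1509; 1383; -3672; 3317; 740; -26; 1; 452; 3184];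
  [:: -18088; -4458; 42171; 18067; 34342; -13030; -34018; -1901; 9097; 15623; -10503; 6327; -35611;
   -12179; 611; 3071; 1207; -6706; 2745; -6334; -56; -728; -244; -378; -700; 330; 2528];
  [:: 1210; 11109; -8014; -57487; -23339; 21957; 33073; -43600; -21303; 50542; -41245; 34434; -46865;
   -4407; -26203; 3346; -3649; -307; 5901; -4510; 4896; -1130; -666; 207; 465; 2829; 1218; 5313];
  [:: -25333; -495; -16781; 15076; 70390; 42556; 67531; -67747; 161628; -59832; -45857; 2515; 69406;
   -53605; -22709; -4220; -10240; 4878; 5346; 9811; -5812; 956; 1040; -1037; -4793; -551; -450; -1562;
   4453];
  [:: -4992; 55679; -29364; 27299; 33302; 21566; -15330; -47633; -87764; 48814; 64610; -17912; -14799;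
   -6948; 7696; 2635; 2429; -5926; 1060; -7765; -1386; -706; 140; 289; -954; -1238; -308; 193; -617;
   3074];
  [:: 6760; -23522; -4055; 17614; -7410; -3582; 5951; 2576; 1801; 10836; -13753; -4538; -9065; 3697;
   -2876; -77; 341; 633; -379; 627; 795; -77; -159; 58; 840; 373; 170; 359; -129; -292; 2040];
  [:: 62322; -43671; -18302; 32044; -55148; -17396; -12389; 15236; 4174; -7464; -22772; -8047; -18790;
   -921; 55; -830; 351; -1969; -2128; 1223; -343; -863; -398; 39; 864; -412; 388; -150; -1129; -184;
   -10; 2366];
  [:: -7844; -52812; -12690; -57179; 42958; -3782; -18634; 78574; 59190; -101182; 16489; -19874; -40715;
   1634; 47660; 3885; 5441; -22099; -2241; -13214; -5770; -759; 89; -1341; -2962; -3531; 473; -4898;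
   -1079; 543; -571; 1816; 4772];
  [:: 46513; 1123; 4200; -16307; 33299; -102107; -65763; -13969; -86415; 69150; 4680; -51925; 6390;
   -49108; -18199; -4088; 160; 3432; -3512; 7029; -4022; -1307; -191; 128; -29; -2295; 71; -1261;
   -1124; 54; -137; 728; 487; 2907];
  [:: 33700; 2372; -47276; 1519; 43675; 48365; -18369; 65754; -22978; -66559; 40137; 24515; 26904; -31730;
   6644; -900; -3717; -6111; 774; -2133; -4823; -2438; -57; -712; -4186; -1609; 502; -1154; -1121;
   1620; -783; 1627; 3058; 204; 3623];
  [:: -7416; -22180; 18374; -23869; -61924; -7356; -42143; -63743; -14500; -5086; -32250; -2226; 5891;
   69973; 15405; -195; 1637; 4864; -879; 2145; 1801; 1509; -13; 655; 2735; 533; -340; 664; 373; -965;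
   496; -948; -2010; -9; -1618; 2416];
  [:: 24009; -29233; -29460; -11589; -519; 45890; -41682; 6576; -11959; -57441; 27598; 14371; 29616;
   36281; 26082; -2; 383; -2670; -357; -1996; -2502; -503; 89; -233; -1389; -980; 4; -915; -268; 652;
   -211; 409; 937; -156; 654; 70; 2185];
  [:: -16910; 25887; 20761; 14796; 27471; -39937; 61123; 13585; 19995; 59355; -9892; -20343; -22956;
   -55636; -28491; -409; -332; 1984; -133; 2191; 1592; 245; 6; 4; 597; 602; -83; 303; 305; -350; 69;
   -185; -328; 94; -230; -299; -387; 2169]]%ZZ.

Definition sharp_minors : seq (Z * mono * nat) := [::
  ((-291683724206921752627643904)%ZZ, [::(0,1);(0,1);(0,1)], 1);
   ((-1201053566299706932624680960)%ZZ, [::(0,1);(0,1);(0,1)], 0);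
   (132845444759683920879912960%ZZ, [::(0,1);(0,1);(2,3)], 0);
   (790986483904529510061400992%ZZ, [::(0,1);(2,3)], 0);
   ((-652617012696197793520376592)%ZZ, [::(0,1);(0,3);(0,4)], 1);
   (1302924503442619746760181760%ZZ, [::(0,1);(2,4);(2,4)], 0);
   (2822375246241362181486087456%ZZ, [::(0,1);(0,4);(2,3)], 0);
   ((-850103837694521890587095040)%ZZ, [::(0,1);(0,2);(1,2)], 0);
   (1975587726711951471535663104%ZZ, [::(0,1);(0,1);(0,4)], 0);
   ((-739613703737917439936953344)%ZZ, [::(0,1);(0,2);(3,4)], 1);
   ((-1573746190520861413657156608)%ZZ, [::(0,1);(0,1);(2,4)], 0);
   ((-3322467640766674669680239520)%ZZ, [::(0,1);(2,4);(3,4)], 0);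
   ((-3735869148344401473901556736)%ZZ, [::(0,1);(0,1)], 0);
   (2308594389944421512838947664%ZZ, [::(0,1);(3,4)], 1);
   (1567931573849642898911778816%ZZ, [::(0,1);(0,2);(0,3)], 1);
   (483978048046322631502970880%ZZ, [::(0,1);(0,2);(0,4)], 0);
   (1364083022880338352810917256%ZZ, [::(0,1);(0,4);(0,4)], 0);
   ((-3362389631347423406553188352)%ZZ, [::(0,1);(0,3);(2,3)], 1);
   ((-4249587522588891644118237696)%ZZ, [::(0,1);(0,4);(1,4)], 0);
   ((-395762391655271788282776576)%ZZ, [::(0,1);(0,1);(3,4)], 1);
   ((-24495112365238690211073024)%ZZ, [::(0,1);(0,1);(0,2)], 0);
   ((-20481542086847721971240448)%ZZ, [::(0,1);(0,1);(0,2)], 1);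
   ((-3693432613660002917485996032)%ZZ, [::(0,1);(0,2);(1,3)], 1);
   ((-204910039495735394004946944)%ZZ, [::(0,3);(0,3);(0,3)], 1);
   (3376804994645483976877845504%ZZ, [::(0,1);(0,3);(3,4)], 1);
   ((-1978243136310235475654438400)%ZZ, [::(0,4);(0,4);(1,4)], 0);
   ((-912205976622563127878019264)%ZZ, [::(0,3);(1,4);(3,4)], 1);
   ((-1294130701701204255306362880)%ZZ, [::(0,1);(0,4);(2,4)], 0);
   (2613958782282502755237835776%ZZ, [::(0,3);(0,4);(1,3)], 1);
   ((-888130500415930730571982416)%ZZ, [::], 0);
   (969327299094691471738113024%ZZ, [::(0,1);(0,2);(1,4)], 0);
   ((-199489663962532155653955072)%ZZ, [::(0,3);(0,3);(3,4)], 1);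
   (238248186183897600154669056%ZZ, [::(0,1);(0,2);(3,4)], 0);
   (3591349064343402091874095296%ZZ, [::(0,1);(2,3);(3,4)], 1);
   (928816709043552118714828800%ZZ, [::(3,4)], 1);
   (1398538047477119505821789184%ZZ, [::(0,4);(0,4)], 0);
   ((-309482421581796750423333024)%ZZ, [::(0,4);(1,4)], 0);
   (1878628457048690604686966784%ZZ, [::(0,1);(0,1)], 1);
   ((-135577309583751683524658136)%ZZ, [::(0,4);(0,4);(0,4)], 0);
   ((-1015715067228797281363630080)%ZZ, [::(0,3);(1,3);(2,3)], 1);
   (2803504243960856290860896544%ZZ, [::(0,1);(2,4)], 0);
   (497767482671096389332971520%ZZ, [::(0,1);(0,2);(1,3)], 0);
   ((-2084383967352122656803787776)%ZZ, [::(0,1);(0,3);(1,3)], 1);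
   (1118353780980553734777139200%ZZ, [::(0,1);(0,2);(0,3)], 0);
   ((-1810872268543710354374115096)%ZZ, [::(0,1)], 0);
   ((-142460278143323590341365760)%ZZ, [::(0,1);(0,3)], 1);
   ((-1615656449721254008382347008)%ZZ, [::(0,1)], 1);
   (4563041285298138824972703744%ZZ, [::(0,1);(0,4)], 0);
   ((-1216584987547130822062301184)%ZZ, [::(0,3);(3,4);(3,4)], 1);
   ((-7427947704379605126202354944)%ZZ, [::(0,3);(1,3)], 1);
   (3390143707958123451089293704%ZZ, [::(0,4)], 0); ((-3341922686622717748707396816)%ZZ, [::(0,3)], 1)].

(** [b = u (u - 1) (2 u - 1) (10 u - 7)], and [r] is the quotient of [K f] by [b^2], so the minorant
    is the remainder, of degree 7. The value 7/10 does not occur at the bi-pyramid; as a double node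
    it keeps the minorant on one side of the potential. Here [e1 = e2 = kappa K / 8]. *)
Lemma sharp_certificate : energy_certificate 10000 [:: 0; 0; 51; 0; 0; 112; 0; 0; 0; 0; 128]%ZZ [:: 0; -7; 31; -44; 20]%ZZ [:: 36544; 14080; 3200]%ZZ
  29289160088248320000 35902500 36611450110310400000000 36611450110310400000000 35891414756074996
  sharp_vectors sharp_gram sharp_cholesky sharp_minors.
Proof. by vm_compute. Qed.

(** * Assembly of the five cases *)

Unset Implicit Arguments.

Theorem theorem1p3 (R : realType) (f : R -> R) :
  (f = G 3 \/ f = G 4 \/ f = G 5 \/ f = G 6 \/ f = @Gsharp10 R) ->
  forall p : 'I_5 -> 'rV[R]_3,
    (forall i, norm3 (p i) = 1) -> injective p ->
    energy f (@tbp R) <= energy f p /\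
    (energy f p = energy f (@tbp R) ->
     exists Q : 'M[R]_3, Q *m Q^T = 1%:M /\
       exists s : 'S_5, forall i, p i = tbp R (s i) *m Q).
Proof.
move=> fG p p1 _; case: fG => [->|[->|[->|[->|->]]]].
- apply: (energy_certificate_minimizer cube_certificate (lam := 2 ^+ 3)) => // [|q i j q1].
    by rewrite exprn_gt0.
  by rewrite G_norm3 //= zr0 zr1; ring.
- apply: (energy_certificate_minimizer quartic_certificate (lam := 2 ^+ 4)) => // [|q i j q1].
    by rewrite exprn_gt0.
  by rewrite G_norm3 //= zr0 zr1; ring.
- apply: (energy_certificate_minimizer quintic_certificate (lam := 2 ^+ 5)) => // [|q i j q1].
    by rewrite exprn_gt0.
  by rewrite G_norm3 //= zr0 zr1; ring.
- apply: (energy_certificate_minimizer sextic_certificate (lam := 2 ^+ 6)) => // [|q i j q1].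
    by rewrite exprn_gt0.
  by rewrite G_norm3 //= zr0 zr1; ring.
(* [2^10 u^10 + 28 * 2^5 u^5 + 102 * 2^2 u^2 = 8 (128 u^10 + 112 u^5 + 51 u^2)]. *)
- apply: (energy_certificate_minimizer sharp_certificate (lam := 8)) => // q i j q1.
  rewrite /Gsharp10 !G_norm3 //= zr0 -[zr R 51%ZZ]/(51 : R) -[zr R 112%ZZ]/(112 : R).
  by rewrite -[zr R 128%ZZ]/(128 : R); ring.
Qed.
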